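(* Let $\gamma\in(0,1)$, $N=\lfloor 1/\gamma\rfloor$, and let $M:\mathcal H\to\mathcal H$ be a linear map such that: (i) $M$ is multiplicative for the forest product and $M\mathbf 1=\mathbf 1$; (ii) $(M\otimes M)\Delta=\Delta M$; (iii) for every non-empty tree $\tau$, $M\tau=\sum_i\lambda_i\tau_i$ is a finite linear combination of trees $\tau_i$ with $\gamma_{\tau_i}\ge\gamma_\tau$ and $|\tau_i|\le|\tau|$. Let $M^*:\mathcal H_N^*\to\mathcal H_N^*$ be the adjoint of the restriction $M:\mathcal H_N\to\mathcal H_N$. Define a linear map $\tilde M^*:T_N(\mathcal B_N)\to T_N(\mathcal B_N)$ by $\tilde M^*(uv)=(\tilde M^*u)(\tilde M^*v)$ for $uv\in T_N(\mathcal B_N)$ (truncated concatenation product, with $\tilde M^*\varepsilon=\varepsilon$), and $\tilde M^*\tau=\Psi(M^*\tau)$ for $\tau\in\mathcal B_N$. Then $$\Psi\circ M^*=\tilde M^*\circ\Psi\quad\text{on }\mathcal H_N^*.$$ Moreover $\tilde M^*$ acts on the space $\mathbf{ARP}^\gamma$ of anisotropic rough paths on $T_N(\mathcal B_N)$: for every $X\in\mathbf{ARP}^\gamma$, $(s,t)\mapsto\tilde M^*X_{st}$ belongs to $\mathbf{ARP}^\gamma$.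
   Context: **Trees and forests.** $\mathcal T$ is the set of (non-planar) rooted trees with nodes decorated by $\{0,\dots,d\}$; $|\tau|$ is the number of nodes and $|\tau|_0$ the number of nodes decorated by $0$; the weight is $\gamma_\tau=(1-\gamma)|\tau|_0+\gamma|\tau|$. $\mathbf 1$ is the empty tree/forest. $\mathcal H$ is the linear span of forests (commutative monomials of trees), with the forest product. $\mathcal H_N$ is the span of forests with at most $N$ nodes in total. $B_+^i(f)$ is the tree obtained by connecting the roots of the trees of the forest $f$ to a new root decorated by $i$. The Butcher–Connes–Kreimer coproduct is the algebra morphism $\Delta:\mathcal H\to\mathcal H\otimes\mathcal H$ with $\Delta\mathbf 1=\mathbf 1\otimes\mathbf 1$ and $\Delta B_+^i(f)=\mathbf 1\otimes B_+^i(f)+(B_+^i\otimes\mathrm{id})\Delta f$. **Dual algebra and the map $\Psi$.** $\mathcal H_N^*$ is the dual of $\mathcal H_N$, an algebra for the convolution $X\star Y=(X\otimes Y)\Delta$ with unit $\mathbf 1^*$ (the functional equal to $1$ on $\mathbf 1$ and $0$ on other forests). A forest is identified with the element of $\mathcal H_N^*$ equal to $1$ on that forest and $0$ on all other forests. By a theorem of Foissy and Chapoton there is a subspace $\mathcal B=\langle\tau_1,\tau_2,\dots\rangle$ of the linear span of non-empty trees, whose basis elements $\tau_i$ are linear combinations of trees all having the same number $|\tau_i|$ of nodes and the same number $|\tau_i|_0$ of nodes decorated by $0$, ordered with $|\tau_i|\le|\tau_j|$ for $i\le j$, such that, with $\mathcal B_N$ the span of the $\tau_i$ with $|\tau_i|\le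 N$, every element of $\mathcal H_N^*$ can be written uniquely as $\sum_R\lambda_R\,\tau_{r_1}\star\cdots\star\tau_{r_n}$, the sum running over multi-indices $R=(r_1,\dots,r_n)$, $n\ge0$, with $\sum_i|\tau_{r_i}|\le N$ (the empty $R$ giving $\mathbf 1^*$). Fix such a $\mathcal B$ and basis. $T_N(\mathcal B_N)$ is the span of words $\tau_{r_1}\otimes\cdots\otimes\tau_{r_n}$ in these basis letters with $\sum_i|\tau_{r_i}|\le N$ (empty word $\varepsilon$), with concatenation, where words exceeding the bound are set to $0$. $\Psi:\mathcal H_N^*\to T_N(\mathcal B_N)$ is the linear isomorphism $\tau_{r_1}\star\cdots\star\tau_{r_n}\mapsto\tau_{r_1}\otimes\cdots\otimes\tau_{r_n}$. **Anisotropic rough paths on $T_N(\mathcal B_N)$.** Put $\gamma_{\tau_i}=(1-\gamma)|\tau_i|_0+\gamma|\tau_i|$. For $X=\sum_w\langle X,w\rangle w\in T_N(\mathcal B_N)$ (sum over words $w$), $X$ is viewed as a linear functional $w\mapsto\langle X,w\rangle$ on words; it is a character if $\langle X,\varepsilon\rangle=1$ and $\langle X,u\sqcup\!\sqcup v\rangle=\langle X,u\rangle\langle X,v\rangle$ for words $u,v$ of total size at most $N$, where $\sqcup\!\sqcup$ is the shuffle product. $\mathbf{ARP}^\gamma$ is the set of maps $X$ from $[0,1]^2$ to such characters with $X_{tt}=\varepsilon$, $X_{st}=X_{su}X_{ut}$ (truncated concatenation, i.e. convolution for deconcatenation) for all $s,u,t\in[0,1]$, and $|\langle X_{st},w\rangle|\lesssim|t-s|^{\gamma_{\tau_{r_1}}+\cdots+\gamma_{\tau_{r_n}}}$,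 uniformly in $s,t$, for each word $w=\tau_{r_1}\otimes\cdots\otimes\tau_{r_n}$. *)

(* Defs.v *)
From HB Require Import structures.
From mathcomp Require Import all_boot all_order all_algebra.
From mathcomp Require Import finmap.
From mathcomp Require Import boolp classical_sets functions reals exp.
From mathcomp Require Import monalg.

Set Implicit Arguments.
Unset Strict Implicit.
Unset Printing Implicit Defensive.

Import Order.TTheory GRing.Theory Num.Theory.
Local Open Scope ring_scope.

(* {malg R[K]} is the free R-module on the basis K: <<k>> is the basis vector *)
(* k and x@_k the coordinate of x on k. lext g is the linear map k |-> g k.   *)
Section LinearExtension.
Context (R : comNzRingType) (K : choiceType) (V : lmodType R).

Definition lext (g : K -> V) (x : {malg R[K]}) : V :=
  \sum_(k <- msupp x) x@_k *: g k.

Lemma lextEw (g : K -> V) (x : {malg R[K]}) (D : {fset K}) :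
  (msupp x `<=` D)%fset -> lext g x = \sum_(k <- D) x@_k *: g k.
Proof.
move=> le; rewrite [LHS](big_fset_incl _ le) => //= k _ /mcoeff_outdom ->.
by rewrite scale0r.
Qed.

Lemma lext_is_linear (g : K -> V) : linear (lext g).
Proof.
move=> c x y /=; set D := (msupp x `|` msupp y)%fset.
rewrite (@lextEw g x D) ?fsubsetUl // (@lextEw g y D) ?fsubsetUr //.
rewrite (@lextEw g _ D); last first.
  apply: fsubset_trans (msuppD_le _ _) _.
  by apply: fsetUSS => //; apply: msuppZ_le.
rewrite scaler_sumr -big_split /=; apply: eq_bigr => k _.
by rewrite mcoeffD mcoeffZ scalerDl scalerA.
Qed.

HB.instance Definition _ (g : K -> V) :=
  GRing.isLinear.Build R {malg R[K]} V *:%R (lext g) (lext_is_linear g).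

Lemma lextU (g : K -> V) k : lext g << k >> = g k.
Proof. by rewrite (lextEw _ msuppU_le) big_seq_fset1 mcoeffUU scale1r. Qed.

Lemma malg_basis (x : {malg R[K]}) : x = \sum_(k <- msupp x) x@_k *: << k >>.
Proof.
rewrite [LHS]monalgE; apply: eq_bigr => k _; apply/malgP => l.
by rewrite mcoeffZ !mcoeffU; case: eqP; rewrite ?mulr1 ?mulr0.
Qed.

Lemma lext_uniq (f : {linear {malg R[K]} -> V}) x :
  f x = lext (fun k => f << k >>) x.
Proof.
rewrite [in LHS](malg_basis x) linear_sum; apply: eq_bigr => k _.
exact: linearZ.
Qed.

End LinearExtension.

Section PlanarTrees.
Context (A : countType).

Inductive ptree := PNode of A & seq ptree.

Fixpoint ptree_ind' (P : ptree -> Prop)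
    (h : forall a ts, (forall i, i < size ts -> P (nth (PNode a [::]) ts i))%N ->
         P (PNode a ts)) (t : ptree) : P t.
Proof.
case: t => a ts; apply: (h).
move: (PNode a [::]) => t0; elim: ts => [|t ts IH] [|i] //= lti.
  exact: (ptree_ind' P h).
exact: IH.
Qed.

Fixpoint ptree_encode (t : ptree) : GenTree.tree A :=
  let: PNode a ts := t in
  GenTree.Node 0 (GenTree.Leaf a :: map ptree_encode ts).

Fixpoint ptree_decode (g : GenTree.tree A) : option ptree :=
  if g is GenTree.Node _ (GenTree.Leaf a :: gs)
  then Some (PNode a (pmap ptree_decode gs)) else None.

Lemma ptree_encodeK : pcancel ptree_encode ptree_decode.
Proof.
elim/ptree_ind' => a ts /= IH; congr (Some (PNode a _)).
move: (PNode a [::]) IH => t0; elim: ts => //= t ts IHts IH.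
rewrite (IH 0%N) //=; congr (_ :: _); apply: IHts => i; exact: (IH i.+1).
Qed.

HB.instance Definition _ := Countable.copy ptree (pcan_type ptree_encodeK).

Definition ple : rel ptree := fun s t => (choice.pickle s <= choice.pickle t)%N.

Lemma ple_total : total ple. Proof. by move=> s t; apply: leq_total. Qed.
Lemma ple_trans : transitive ple. Proof. by move=> s t u; apply: leq_trans. Qed.
Lemma ple_anti : antisymmetric ple.
Proof.
move=> s t H; apply: (pcan_inj (@choice.pickleK ptree)); apply/eqP.
by rewrite eqn_leq.
Qed.

Fixpoint canon (t : ptree) : ptree :=
  let: PNode a ts := t in PNode a (sort ple (map canon ts)).

Lemma canonK : forall t, canon (canon t) = canon t.
Proof.
elim/ptree_ind' => a ts IH /=; congr PNode.
rewrite -[RHS](sorted_sort ple_trans (sort_sorted ple_total _)).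
congr sort; rewrite -[RHS]map_id; apply/eq_in_map => t.
rewrite mem_sort => /mapP[u uts ->].
have := IH (index u ts); rewrite index_mem nth_index //; exact.
Qed.

(* Equality of planar trees up to permutation of the children of every node.  *)
Inductive iso_tree : ptree -> ptree -> Prop :=
  IsoNode a ts us vs of perm_eq us vs & iso_forest ts us :
    iso_tree (PNode a ts) (PNode a vs)
with iso_forest : seq ptree -> seq ptree -> Prop :=
| IsoNil : iso_forest [::] [::]
| IsoCons t u ts us of iso_tree t u & iso_forest ts us :
    iso_forest (t :: ts) (u :: us).

Scheme iso_tree_mind := Minimality for iso_tree Sort Prop
with iso_forest_mind := Minimality for iso_forest Sort Prop.

Lemma canonP t u : canon t = canon u <-> iso_tree t u.
Proof.
split; last first.
  move: t u; apply: (@iso_tree_mind _ (fun ts us => map canon ts = map canon us)).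
  - move=> a ts us vs p _ E /=; rewrite E; congr PNode.
    by apply/perm_sortP; [exact: ple_total|exact: ple_trans|exact: ple_anti|
      exact: perm_map].
  - by [].
  - by move=> t u ts us _ E1 _ E2 /=; rewrite E1 E2.
elim/ptree_ind': t u => a ts IH [b vs] /= [<- /perm_sortP E].
have {E} : perm_eq (map canon ts) (map canon vs).
  by apply: E; [exact: ple_total|exact: ple_trans|exact: ple_anti].
move=> p; have [us puv eqs] : exists2 us, perm_eq us vs &
    map canon ts = map canon us.
  case/(perm_iotaP (canon (PNode a [::]))): p => /= js pjs eqjs.
  rewrite size_map in pjs.
  exists (map (nth (PNode a [::]) vs) js).
    by apply/(perm_iotaP (PNode a [::])); exists js.
  rewrite eqjs -map_comp; apply/eq_in_map => i; rewrite (perm_mem pjs) mem_iota.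
  by move=> /andP[_ ilt] /=; rewrite (nth_map (PNode a [::])).
apply: IsoNode puv _; move: (PNode a [::]) IH => t0.
elim: ts us eqs {vs p} => [|t ts IHts] [|u us] //=; first by constructor.
case=> e1 e2 IH; constructor; first exact: (IH 0).
by apply: IHts => // i; apply: (IH i.+1).
Qed.

End PlanarTrees.

Section TreesForests.
Context (d : nat).

Local Notation pt := (ptree 'I_d.+1).

(* Non-planar trees, as canonical representatives of the classes of iso_tree. *)
Record tree := Tree { tree_val : pt; _ : canon tree_val == tree_val }.
HB.instance Definition _ := [isSub for tree_val].
HB.instance Definition _ := [Choice of tree by <:].

Fact mktree_subproof (t : pt) : canon (canon t) == canon t.
Proof. exact/eqP/canonK. Qed.

Definition mktree (t : pt) : tree := Tree (mktree_subproof t).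

Lemma mktreeP t u : mktree t = mktree u <-> iso_tree t u.
Proof. by rewrite -canonP; split => [[]//|h]; apply: val_inj. Qed.

Lemma mktreeK (t : tree) : mktree (tree_val t) = t.
Proof. by apply: val_inj => /=; apply/eqP; case: t. Qed.

(* Forests are commutative monomials in the trees: mone is the empty forest,  *)
(* mmul the forest product, ucm t the forest t, f t the multiplicity of t.    *)
Definition forest : Type := {cmonom tree}.
HB.instance Definition _ := ConomialDef.on forest.

Definition melems (f : forest) : seq tree :=
  flatten [seq nseq (f t) t | t <- finsupp f].

Definition Bplus (i : 'I_d.+1) (f : forest) : tree :=
  mktree (PNode i (map tree_val (melems f))).

Fixpoint pnodes (t : pt) : nat :=
  let: PNode _ ts := t in (sumn (map pnodes ts)).+1.

Fixpoint pnodes0 (t : pt) : nat :=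
  let: PNode i ts := t in ((i == ord0) + sumn (map pnodes0 ts))%N.

Definition tnodes (t : tree) : nat := pnodes (tree_val t).
Definition tnodes0 (t : tree) : nat := pnodes0 (tree_val t).

Definition fnodes (f : forest) : nat :=
  (\sum_(t <- finsupp f) f t * tnodes t)%N.

End TreesForests.

Section PairMonomial.
Context (A B : conomType).

Let pone : A * B := (mone, mone).
Let pmul (x y : A * B) : A * B := (mmul x.1 y.1, mmul x.2 y.2).

Fact pmulA : associative pmul.
Proof. by move=> x y z; rewrite /pmul !mulmA. Qed.
Fact pmul1m : left_id pone pmul.
Proof. by case=> x y; rewrite /pmul !mul1m. Qed.
Fact pmulm1 : right_id pone pmul.
Proof. by case=> x y; rewrite /pmul !mulm1. Qed.
Fact punitm x y : pmul x y = pone -> x = pone /\ y = pone.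
Proof.
by case: x y => [a b] [a' b'] [] /unitm[-> ->] /unitm[-> ->].
Qed.
Fact pmulC : commutative pmul.
Proof. by move=> x y; rewrite /pmul mulmC [mmul x.2 _]mulmC. Qed.

HB.instance Definition _ :=
  Choice_isMonomialDef.Build (A * B)%type pmulA pmul1m pmulm1 punitm.
HB.instance Definition _ :=
  MonomialDef_isConomialDef.Build (A * B)%type pmulC.
End PairMonomial.

Section Coproduct.
Context (R : comNzRingType) (d : nat).

Definition BCK : Type := {malg R[forest d]}.
HB.instance Definition _ := GRing.ComAlgebra.on BCK.

(* BCK tensor BCK, on the basis of pairs: <<(f, g)>> is f tensor g.           *)
Definition BCK2 : Type := {malg R[(forest d * forest d)%type]}.
HB.instance Definition _ := GRing.ComAlgebra.on BCK2.

Definition fvec (f : forest d) : BCK := << f >>.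
Definition tvec (t : tree d) : BCK := fvec (ucm t).

Definition tensor (x y : BCK) : BCK2 :=
  lext (fun f => lext (fun g => << (f, g) >> : BCK2) y) x.

Definition tensor_map (L L' : BCK -> BCK) : BCK2 -> BCK2 :=
  lext (fun p => tensor (L (fvec p.1)) (L' (fvec p.2))).

Definition BplusL (i : 'I_d.+1) : BCK -> BCK :=
  lext (fun f => tvec (Bplus i f)).

Fixpoint pcop (t : ptree 'I_d.+1) : BCK2 :=
  let: PNode i ts := t in
  tensor 1 (tvec (mktree t))
  + tensor_map (BplusL i) id (foldr *%R 1 (map pcop ts)).

Definition fcop (f : forest d) : BCK2 :=
  \prod_(t <- finsupp f) pcop (tree_val t) ^+ f t.

Definition coprod : BCK -> BCK2 := lext fcop.
HB.instance Definition _ := GRing.Linear.on coprod.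

Lemma coprod_fvec f : coprod (fvec f) = fcop f.
Proof. exact: lextU. Qed.

Lemma fcopEw (f : forest d) (D : {fset tree d}) : (finsupp f `<=` D)%fset ->
  fcop f = \prod_(t <- D) pcop (tree_val t) ^+ f t.
Proof.
move=> le; rewrite [LHS](big_fset_incl _ le) => //= t _ tf.
by rewrite (fsfun_dflt tf) expr0.
Qed.

Lemma fcopM f g : fcop (mmul f g) = fcop f * fcop g.
Proof.
set D := (finsupp f `|` finsupp g)%fset.
rewrite (@fcopEw f D) ?fsubsetUl // (@fcopEw g D) ?fsubsetUr //.
rewrite (@fcopEw _ D) ?mdomD // -big_split /=.
by apply: eq_bigr => t _; rewrite cmM exprD.
Qed.

Lemma coprod1 : coprod 1 = 1.
Proof.
have -> : 1 = fvec mone :> BCK by [].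
by rewrite coprod_fvec /fcop mdom1 big_seq_fset0.
Qed.

Lemma fvecE (x : BCK) : x = \sum_(f <- msupp x) x@_f *: fvec f.
Proof. exact: malg_basis. Qed.

Lemma fvecM f g : fvec f * fvec g = fvec (mmul f g).
Proof. by rewrite /fvec [LHS]malgM_def fgmulUU mulr1. Qed.

Lemma coprodM x y : coprod (x * y) = coprod x * coprod y.
Proof.
have H f : coprod (fvec f * y) = fcop f * coprod y.
  rewrite {1}(fvecE y) mulr_sumr linear_sum [coprod y]/lext mulr_sumr.
  apply: eq_bigr => g _.
  by rewrite -scalerAr linearZ /= fvecM coprod_fvec fcopM -scalerAr.
rewrite {1}(fvecE x) mulr_suml linear_sum [coprod x]/lext mulr_suml.
by apply: eq_bigr => f _; rewrite -scalerAl linearZ /= H -scalerAl.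
Qed.

Lemma tensorU (f g : forest d) : tensor (fvec f) (fvec g) = << (f, g) >>.
Proof. by rewrite /tensor lextU lextU. Qed.

Lemma pcopE i ts : pcop (PNode i ts) =
  tensor 1 (tvec (mktree (PNode i ts)))
  + tensor_map (BplusL i) id (\prod_(t <- ts) pcop t).
Proof. by rewrite -[\prod_(t <- ts) _](big_map pcop xpredT id) -foldrE. Qed.

Lemma pcop_canon t : pcop (canon t) = pcop t.
Proof.
elim/ptree_ind': t => i ts IH.
have E1 : mktree (canon (PNode i ts)) = mktree (PNode i ts).
  by apply: val_inj; apply: canonK.
have E2 : \prod_(t <- sort (@ple _) (map (@canon _) ts)) pcop t =
          \prod_(t <- ts) pcop t.
  rewrite (perm_big (map (@canon _) ts)) ?perm_sort //= big_map.
  rewrite big_seq [RHS]big_seq; apply: eq_bigr => t tts.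
  have := IH (index t ts); rewrite index_mem nth_index //; exact.
by rewrite [RHS]pcopE -E1 -E2 -pcopE.
Qed.

Lemma fcop_prod f :
  fcop f = \prod_(t <- melems f) pcop (tree_val t).
Proof.
rewrite /fcop /melems big_flatten big_map; apply: eq_bigr => t _.
by rewrite big_nseq; elim: (f t) => [|n IH]; rewrite ?expr0 ?exprS ?IH.
Qed.

(* The two equations that characterize the Butcher-Connes-Kreimer coproduct   *)
(* as an algebra morphism.                                                    *)
Lemma coprod_Bplus i f :
  coprod (tvec (Bplus i f)) =
  tensor 1 (tvec (Bplus i f)) + tensor_map (BplusL i) id (coprod (fvec f)).
Proof.
transitivity (fcop (ucm (Bplus i f))); first exact: coprod_fvec.
rewrite (coprod_fvec f).
have -> : fcop (ucm (Bplus i f)) = pcop (tree_val (Bplus i f)).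
  by rewrite /fcop mdomU big_seq_fset1 cmUU expr1.
by rewrite pcop_canon pcopE big_map -fcop_prod.
Qed.

End Coproduct.

Section Dual.
Context (R : realType) (d N : nat).

Definition forestN : Type := {f : forest d | (fnodes f <= N)%N}.
HB.instance Definition _ := Choice.on forestN.

(* The dual of the span of forestN: a functional is given by its values on    *)
(* the basis forestN.                                                         *)
Definition dual : Type := forestN -> R^o.
HB.instance Definition _ := GRing.Lmodule.on dual.

(* Value of X on a forest, with junk value 0 beyond N nodes.                  *)
Definition dval (X : dual) (f : forest d) : R^o := oapp X 0 (insub f).

Definition dpair (X : dual) : BCK R d -> R^o := lext (dval X).

Definition dpair2 (X Y : dual) : BCK2 R d -> R^o :=
  lext (fun p => dval X p.1 * dval Y p.2 : R^o).

Definition star (X Y : dual) : dual :=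
  fun f => dpair2 X Y (coprod (fvec R (val f))).

Definition dunit : dual := fun f => (val f == mone)%:R.

(* A forest as the functional 1 on that forest and 0 on the others, extended  *)
(* linearly.                                                                  *)
Definition as_dual (x : BCK R d) : dual := fun f => x@_(val f).

(* M^* X = X o M; meaningful when M preserves the span of forestN.            *)
Definition adjoint (M : BCK R d -> BCK R d) (X : dual) : dual :=
  fun f => dpair X (M (fvec R (val f))).

Section Words.
Context (deg : nat -> nat).

(* The word tau_(r_1) ... tau_(r_n) is encoded by [:: r_1; ...; r_n].         *)
Definition wdeg (w : seq nat) : nat := (\sum_(i <- w) deg i)%N.

Definition word : Type := {w : seq nat | (wdeg w <= N)%N}.
HB.instance Definition _ := Choice.on word.

Definition TN : Type := {malg R[word]}.
HB.instance Definition _ := GRing.Lmodule.on TN.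

(* The basis vector w, or 0 if w exceeds the bound.                           *)
Definition wvec (w : seq nat) : TN := oapp (fun u : word => << u >>) 0 (insub w).

Definition wcoef (X : TN) (w : seq nat) : R := oapp (fun u : word => X@_u) 0 (insub w).

Definition concat (X Y : TN) : TN :=
  lext (fun u : word => lext (fun v : word => wvec (val u ++ val v)) Y) X.

Fixpoint shuffle (u : seq nat) : seq nat -> seq (seq nat) :=
  if u is a :: u' then
    fix shuffle_u (v : seq nat) : seq (seq nat) :=
      if v is b :: v' then
        map (cons a) (shuffle u' v) ++ map (cons b) (shuffle_u v')
      else [:: u]
  else fun v => [:: v].

Definition character (X : TN) : Prop :=
  wcoef X [::] = 1 /\
  forall u v : seq nat, (wdeg u + wdeg v <= N)%N ->
    \sum_(w <- shuffle u v) wcoef X w = wcoef X u * wcoef X v.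

Section Basis.
Context (tau : nat -> BCK R d).

Definition starw (w : seq nat) : dual :=
  foldr star dunit [seq as_dual (tau i) | i <- w].

Definition starL : TN -> dual := lext (fun w : word => starw (val w)).
HB.instance Definition _ := GRing.Linear.on starL.

Definition Psi (X : dual) : TN := xget 0 [set l | X = starL l]%classic.

End Basis.
End Words.
End Dual.

Arguments wvec {R N deg} w.
Arguments wcoef {R N deg} X w.

(* tau enumerates a basis of a subspace of the span of trees as given by the  *)
(* theorem of Foissy and Chapoton; deg i and deg0 i are the numbers of nodes  *)
(* and of nodes decorated by 0 of the trees of tau i.                         *)
Record FC_basis (R : realType) (d N : nat) (tau : nat -> BCK R d)
    (deg deg0 : nat -> nat) : Prop := {
  FC_tree : forall i f, f \in msupp (tau i) ->
    exists t : tree d, [/\ f = ucm t, tnodes t = deg i & tnodes0 t = deg0 i];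
  FC_free : forall c : {malg R[nat]}, lext tau c = 0 -> c = 0;
  FC_mono : forall i j, (i <= j)%N -> (deg i <= deg j)%N;
  FC_expand : forall X : dual R d N,
    exists! l : TN R N deg, X = starL tau l }.

Section PsiTheory.
Context (R : realType) (d N : nat) (tau : nat -> BCK R d) (deg deg0 : nat -> nat).
Hypothesis tauP : FC_basis N tau deg deg0.

Local Notation starL := (@starL R d N deg tau).
Local Notation Psi := (@Psi R d N deg tau).

Lemma PsiK : cancel Psi starL.
Proof.
move=> X; have [l [Xl _]] := FC_expand tauP X.
by have := @xgetI _ 0 [set l | X = starL l]%classic l Xl.
Qed.

Lemma starLK : cancel starL Psi.
Proof.
move=> l; have [k [_ uk]] := FC_expand tauP (starL l).
by transitivity k; [apply/esym/uk; rewrite PsiK|exact: uk].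
Qed.

Lemma Psi_is_linear : linear Psi.
Proof.
move=> c X Y; apply: (can_inj starLK).
by rewrite linearP /= !PsiK.
Qed.

Lemma Psi_starw w : (wdeg deg w <= N)%N -> Psi (starw tau w) = wvec w.
Proof.
move=> lew; rewrite -[RHS]starLK /wvec insubT /=.
by congr Psi; rewrite /Defs.starL lextU.
Qed.
End PsiTheory.

Section RoughPaths.
Context (R : realType) (d N : nat) (gamma : R).

Definition weight (n0 n : nat) : R := (1 - gamma) * n0%:R + gamma * n%:R.

Definition tweight (t : tree d) : R := weight (tnodes0 t) (tnodes t).

Section ARP.
Context (deg deg0 : nat -> nat).

Definition wweight (w : seq nat) : R := \sum_(i <- w) weight (deg0 i) (deg i).

Definition ARP (X : R -> R -> TN R N deg) : Prop :=
  let in01 (s : R) := 0 <= s <= 1 in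
  [/\ forall s t, in01 s -> in01 t -> character (X s t),
      forall t, in01 t -> X t t = wvec [::],
      forall s u t, in01 s -> in01 u -> in01 t ->
        X s t = concat (X s u) (X u t)
    & forall w : word N deg, exists C : R, forall s t, in01 s -> in01 t ->
        `|(X s t)@_w| <= C * (`|t - s| `^ wweight (val w))].
End ARP.

(* The defining equations of the map M~^*.                                    *)
Definition is_Mtilde (tau : nat -> BCK R d) (deg : nat -> nat)
    (M : BCK R d -> BCK R d) (Mt : TN R N deg -> TN R N deg) : Prop :=
  [/\ Mt (wvec [::]) = wvec [::],
      forall u v, (wdeg deg (u ++ v) <= N)%N ->
        Mt (wvec (u ++ v)) = concat (Mt (wvec u)) (Mt (wvec v))
    & forall i, (deg i <= N)%N ->
        Mt (wvec [:: i]) = Psi deg tau (adjoint M (as_dual (tau i)))].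
End RoughPaths.

(* Main.v *)
Require Import Defs.
From HB Require Import structures.
From mathcomp Require Import all_boot all_order all_algebra.
From mathcomp Require Import finmap.
From mathcomp Require Import boolp classical_sets functions reals exp.
From mathcomp Require Import monalg.

Set Implicit Arguments.
Unset Strict Implicit.
Unset Printing Implicit Defensive.

Import Order.TTheory GRing.Theory Num.Theory.
Local Open Scope ring_scope.

(* The idea is to define Mtilde as Psi o M^* o Psi^-1, so that the intertwining
   relation is immediate, and to check its properties on the dual side.
   Compatibility of M with the coproduct makes M^* an endomorphism of the
   convolution algebra, while Psi is an algebra isomorphism because the coproduct
   is coassociative, counital and graded; hence Mtilde is multiplicative.
   Each tau_i is supported on trees, so it is primitive for the coproduct dual to
   the forest product.  Hence Psi transports this coproduct to the unshuffle
   coproduct, and X is a character of the shuffle algebra if and only if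
   Psi^-1 X is multiplicative for the forest product; this property is clearly
   preserved by M^*.
   A word w of total weight c corresponds to a functional supported on forests
   of weight c, and M^* never increases weights; so <Mtilde u, w> = 0 unless w
   weighs at most as much as u, which gives the estimates because |t - s| <= 1
   and there are finitely many words. *)

(** * Linear extensions from a basis and their supports *)

Section FreeModule.
Context (R : comNzRingType) (K : choiceType).
Implicit Types (V W : lmodType R) (x y : {malg R[K]}).

Lemma eq_lext V (g h : K -> V) x : {in msupp x, g =1 h} -> lext g x = lext h x.
Proof. by move=> E; apply: eq_big_seq => k /E ->. Qed.

Lemma linear_lext V W (h : {linear V -> W}) (g : K -> V) x :
  h (lext g x) = lext (h \o g) x.
Proof. by rewrite linear_sum; apply: eq_bigr => k _; rewrite linearZ. Qed.

(** Version for maps whose linearity is only a proposition, such as convolution with a fixed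
    factor. *)
Lemma linear_lextP V W (h : V -> W) (g : K -> V) x :
  linear h -> h (lext g x) = lext (h \o g) x.
Proof.
move=> hl; pose H : {linear V -> W} :=
  HB.pack h (GRing.isLinear.Build R V W *:%R h hl).
exact: (linear_lext H).
Qed.

Lemma lext_lext V (L : choiceType) (h : L -> V) (g : K -> {malg R[L]}) x :
  lext h (lext g x) = lext (fun k => lext h (g k)) x.
Proof. exact: (linear_lext (lext h)). Qed.

Lemma lext_add V (g h : K -> V) x :
  lext (fun k => g k + h k) x = lext g x + lext h x.
Proof. by rewrite /lext -big_split; apply: eq_bigr => k _; rewrite scalerDr. Qed.

Lemma scale_lext V c (g : K -> V) x :
  c *: lext g x = lext (fun k => c *: g k) x.
Proof.
rewrite scaler_sumr; apply: eq_bigr => k _.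
by rewrite !scalerA mulrC.
Qed.

Lemma msupp_sum (L : choiceType) (I : eqType) (s : seq I)
    (F : I -> {malg R[L]}) k :
  k \in msupp (\sum_(i <- s) F i) -> exists2 i, i \in s & k \in msupp (F i).
Proof.
elim: s => [|i s IH]; first by rewrite big_nil msupp0.
rewrite big_cons => /(fsubsetP (msuppD_le _ _)); rewrite in_fsetU => /orP[ki|].
  by exists i => //; rewrite mem_head.
by case/IH=> j js kj; exists j => //; rewrite in_cons js orbT.
Qed.

Lemma msupp_lext (L : choiceType) (g : K -> {malg R[L]}) x l :
  l \in msupp (lext g x) -> exists2 k, k \in msupp x & l \in msupp (g k).
Proof.
case/msupp_sum=> k kx lk; exists k => //.
exact: (fsubsetP (msuppZ_le _ _)) lk.
Qed.

End FreeModule.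

(** * Linear extensions on monoid algebras *)

Section MonoidAlgebra.
Context (R : comNzRingType) (K : conomType) (A : comAlgType R).
Implicit Types (x y : {malg R[K]}).

(** The form with a sum serves functionals that are not multiplicative but have a finite coproduct,
    such as convolution products of primitive elements. *)
Lemma lextM_sum (I : Type) (s : seq I) (g : K -> A) (g1 g2 : I -> K -> A) x y :
  {in msupp x & msupp y, forall a b,
     g (mmul a b) = \sum_(i <- s) g1 i a * g2 i b} ->
  lext g (x * y) = \sum_(i <- s) lext (g1 i) x * lext (g2 i) y.
Proof.
move=> gM; rewrite {1}(malg_basis x) {1}(malg_basis y) mulr_suml linear_sum.
under [RHS]eq_bigr do rewrite mulr_suml.
rewrite [RHS]exchange_big; apply: eq_big_seq => a ax.
rewrite mulr_sumr linear_sum.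
under [RHS]eq_bigr do rewrite mulr_sumr.
rewrite [RHS]exchange_big; apply: eq_big_seq => b bY.
rewrite -scalerAl -scalerAr scalerA linearZ /=.
rewrite [X in lext g X]malgM_def fgmulUU mulr1 lextU gM // scaler_sumr.
by apply: eq_bigr => i _; rewrite -scalerAl -scalerAr scalerA.
Qed.

(** Multiplicativity is asked only on the supports, because functionals truncated at [N] nodes are
    multiplicative only within the bound. *)
Lemma lextM_in (g g1 g2 : K -> A) x y :
  {in msupp x & msupp y, forall a b, g (mmul a b) = g1 a * g2 b} ->
  lext g (x * y) = lext g1 x * lext g2 y.
Proof.
move=> gM; pose s := [:: tt].
rewrite (@lextM_sum _ s g (fun=> g1) (fun=> g2)) ?big_seq1 // => a b ax bY.
by rewrite big_seq1 gM.
Qed.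

Lemma lextM (g : K -> A) : {morph g : a b / mmul a b >-> a * b} ->
  {morph lext g : x y / x * y}.
Proof. by move=> gM x y; apply: lextM_in => a b _ _; apply: gM. Qed.

End MonoidAlgebra.

Lemma malgUM (R : comNzRingType) (K : conomType) (a b : K) :
  << a >> * << b >> = << mmul a b >> :> {malg R[K]}.
Proof. by rewrite malgM_def fgmulUU mulr1. Qed.

(** * Forests and their weights *)

Lemma ptree_ind_in (A : countType) (P : ptree A -> Prop) :
  (forall a ts, {in ts, forall t, P t} -> P (PNode a ts)) -> forall t, P t.
Proof.
move=> H; elim/ptree_ind' => a ts IH; apply: H => t tts.
have := IH (index t ts); rewrite index_mem nth_index //.
exact.
Qed.

Section Forests.
Context (d : nat).
Implicit Types (t : tree d) (f g : forest d).

Lemma count_melems f t : count_mem t (melems f) = f t.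
Proof.
rewrite /melems count_flatten -map_comp sumnE big_map.
have [tf|tf] := boolP (t \in finsupp f).
  rewrite (bigD1_seq t) ?fset_uniq //= count_nseq /= eqxx mul1n big1 ?addn0 //.
  by move=> u /negPf ut; rewrite count_nseq /= ut.
rewrite (fsfun_dflt tf) big1_seq // => u /= uf.
rewrite count_nseq /=; case: eqP => [ut|]; last by rewrite mul0n.
by rewrite -ut uf in tf.
Qed.

Lemma perm_melemsM f g :
  perm_eq (melems (mmul f g)) (melems f ++ melems g).
Proof. by apply/allP => t _ /=; rewrite count_cat !count_melems cmM. Qed.

Lemma melems1 : melems (mone : forest d) = [::].
Proof.
case E: (melems _) => [//|t s].
by have := count_melems mone t; rewrite E /= eqxx cm1.
Qed.

Lemma melemsU t : melems (ucm t : forest d) = [:: t].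
Proof.
apply: perm_small_eq => //; apply/allP => u _ /=.
by rewrite count_melems cmU addn0 eq_sym.
Qed.

Lemma forest_prod f : f = \big[mmul/mone]_(t <- melems f) ucm t.
Proof.
apply/eqP/cmP => t; rewrite -count_melems.
elim: (melems f) => [|u s IH]; first by rewrite big_nil cm1.
by rewrite big_cons cmM cmU /= IH.
Qed.

Lemma forest_ind (P : forest d -> Prop) :
  P mone -> (forall t f, P f -> P (mmul (ucm t) f)) -> forall f, P f.
Proof.
move=> P1 PM f; rewrite (forest_prod f).
by elim: (melems f) => [|t s IH]; rewrite ?big_nil // big_cons; apply: PM.
Qed.

Lemma fnodes_melems f : fnodes f = (\sum_(t <- melems f) tnodes t)%N.
Proof.
rewrite /melems big_flatten big_map; apply: eq_bigr => t _.
by rewrite big_nseq iter_addn_0 mulnC.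
Qed.

Lemma pnodes_canon (t : ptree 'I_d.+1) : pnodes (Defs.canon t) = pnodes t.
Proof.
elim/ptree_ind_in: t => a ts IH /=; congr _.+1; rewrite !sumnE !big_map.
rewrite (perm_big (map (@Defs.canon _) ts)) ?perm_sort //= big_map.
rewrite big_seq [RHS]big_seq; apply: eq_bigr => t tts.
exact: IH.
Qed.

Lemma pnodes0_canon (t : ptree 'I_d.+1) : pnodes0 (Defs.canon t) = pnodes0 t.
Proof.
elim/ptree_ind_in: t => a ts IH /=; congr addn; rewrite !sumnE !big_map.
rewrite (perm_big (map (@Defs.canon _) ts)) ?perm_sort //= big_map.
rewrite big_seq [RHS]big_seq; apply: eq_bigr => t tts.
exact: IH.
Qed.

Lemma tnodes_gt0 t : (0 < tnodes t)%N.
Proof. by rewrite /tnodes; case: (tree_val t). Qed.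

End Forests.

(** * Additivity of the anisotropic weight *)

Section Weight.
Context (R : realType) (d : nat) (gamma : R).
Implicit Types (t : tree d) (f g : forest d).

Definition fweight f : R := \sum_(t <- melems f) tweight gamma t.

Lemma fweight1 : fweight mone = 0.
Proof. by rewrite /fweight melems1 big_nil. Qed.

Lemma fweightU t : fweight (ucm t) = tweight gamma t.
Proof. by rewrite /fweight melemsU big_seq1. Qed.

Lemma fweightM f g : fweight (mmul f g) = fweight f + fweight g.
Proof. by rewrite /fweight (perm_big _ (perm_melemsM f g)) big_cat. Qed.

Lemma weight0 : weight gamma 0 0 = 0.
Proof. by rewrite /weight !mulr0 addr0. Qed.

Lemma weightD m0 m n0 n :
  weight gamma (m0 + n0) (m + n) = weight gamma m0 m + weight gamma n0 n.
Proof. by rewrite /weight !natrD !mulrDr addrACA. Qed.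

Definition pweight (t : ptree 'I_d.+1) := weight gamma (pnodes0 t) (pnodes t).

Lemma pweight_canon (t : ptree 'I_d.+1) : pweight (Defs.canon t) = pweight t.
Proof. by rewrite /pweight pnodes_canon pnodes0_canon. Qed.

Lemma pweight_node i ts :
  pweight (PNode i ts) =
  weight gamma (i == ord0) 1 + \sum_(t <- ts) pweight t.
Proof.
rewrite /pweight /= -[(sumn _).+1]add1n weightD; congr (_ + _).
elim: ts => [|t ts IH] /=; first by rewrite big_nil weight0.
by rewrite weightD IH big_cons.
Qed.

Lemma tweight_Bplus i f :
  tweight gamma (Bplus i f) = weight gamma (i == ord0) 1 + fweight f.
Proof.
by rewrite /tweight -/(pweight _) pweight_canon pweight_node big_map.
Qed.

End Weight.

(** At gamma = 1 the weight counts nodes, so facts on node numbers become instances of facts on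
    weights. *)
Lemma fweight_fnodes (R : realType) d (f : forest d) :
  fweight 1 f = (fnodes f)%:R :> R.
Proof.
rewrite fnodes_melems natr_sum; apply: eq_bigr => t _.
by rewrite /tweight /weight subrr mul0r add0r mul1r.
Qed.

(** * Coassociativity and counits of the Butcher-Connes-Kreimer coproduct *)

Section Coassociativity.
Context (R : comNzRingType) (d : nat).
Local Notation F := (forest d).
Local Notation BCK3 := {malg R[(F * (F * F))%type]}.
Implicit Types (x y : BCK2 R d) (X Y Z : F -> R^o).

Lemma tensor_map_BplusL i x :
  tensor_map (@BplusL R d i) id x = lext (fun p => << (ucm (Bplus i p.1), p.2) >>) x.
Proof. by apply: eq_lext => p _; rewrite [BplusL i _]lextU tensorU. Qed.

Lemma tensor1U (t : tree d) :
  tensor 1 (tvec R t) = << (mone, ucm t) >> :> BCK2 R d.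
Proof. exact: tensorU. Qed.

Lemma fcopU (t : tree d) : fcop R (ucm t) = pcop R (tree_val t).
Proof. by rewrite fcop_prod melemsU big_seq1. Qed.

Lemma fcop_Bplus i (f : F) : fcop R (ucm (Bplus i f)) =
  << (mone, ucm (Bplus i f)) >>
  + lext (fun p => << (ucm (Bplus i p.1), p.2) >>) (fcop R f).
Proof.
by rewrite -coprod_fvec coprod_Bplus coprod_fvec tensor_map_BplusL tensorU.
Qed.

Lemma fcop1 : fcop R (mone : F) = 1.
Proof. by rewrite fcop_prod melems1 big_nil. Qed.

(* [coprodl] is (Delta (x) id) and [coprodr] is (id (x) Delta). *)
Definition coprodl : BCK2 R d -> BCK3 :=
  lext (fun p => lext (fun q => << (q.1, (q.2, p.2)) >>) (fcop R p.1)).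
HB.instance Definition _ := GRing.Linear.on coprodl.

Definition coprodr : BCK2 R d -> BCK3 :=
  lext (fun p => lext (fun q => << (p.1, q) >>) (fcop R p.2)).
HB.instance Definition _ := GRing.Linear.on coprodr.

Lemma coprodlM : {morph coprodl : x y / x * y}.
Proof.
apply: lextM => p p' /=; rewrite fcopM; apply: lextM_in => q q' _ _.
by rewrite malgUM.
Qed.

Lemma coprodrM : {morph coprodr : x y / x * y}.
Proof.
apply: lextM => p p' /=; rewrite fcopM; apply: lextM_in => q q' _ _.
by rewrite malgUM.
Qed.

Lemma coprodl1 : coprodl 1 = 1.
Proof. by rewrite /coprodl lextU /= fcop1 lextU. Qed.

Lemma coprodr1 : coprodr 1 = 1.
Proof. by rewrite /coprodr lextU /= fcop1 lextU. Qed.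

Lemma morph_prod_seq (A B : pzSemiRingType) (h : A -> B) I (s : seq I) (F : I -> A) :
  h 1 = 1 -> {morph h : x y / x * y} ->
  h (\prod_(i <- s) F i) = \prod_(i <- s) h (F i).
Proof. by move=> h1 hM; apply: big_morph. Qed.

(** [BL i] is B_+^i (x) id, [B3 i] is B_+^i (x) id (x) id, and [I3] is x |-> 1 (x) x. *)
Let BL i : BCK2 R d -> BCK2 R d := tensor_map (@BplusL R d i) id.
Let B3 i : BCK3 -> BCK3 := lext (fun r => << (ucm (Bplus i r.1), r.2) >>).
Let I3 : BCK2 R d -> BCK3 := lext (fun p => << (mone, p) >>).

Lemma coprodr_BplusL i x : coprodr (BL i x) = B3 i (coprodr x).
Proof.
rewrite /BL tensor_map_BplusL /coprodr /B3 [LHS]lext_lext [RHS]lext_lext.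
apply: eq_lext => p _; rewrite [LHS]lextU [RHS]lext_lext.
by apply: eq_lext => q _; rewrite lextU.
Qed.

(** The extra term [I3] comes from the summand 1 (x) B_+(f) in the coproduct of the left factor. *)
Lemma coprodl_BplusL i x : coprodl (BL i x) = I3 (BL i x) + B3 i (coprodl x).
Proof.
rewrite /BL tensor_map_BplusL /coprodl /B3 /I3 [LHS]lext_lext.
rewrite [X in _ = X + _]lext_lext [X in _ = _ + X]lext_lext -lext_add.
apply: eq_lext => p _; rewrite [LHS]lextU [X in _ = X + _]lextU fcop_Bplus.
rewrite linearD [X in X + _ = _]lextU; congr (_ + _).
rewrite [LHS]lext_lext [RHS]lext_lext.
by apply: eq_lext => q _; rewrite [LHS]lextU [RHS]lextU.
Qed.

Lemma coprodr_pcop_unit t : coprodr (tensor 1 (tvec R (mktree t))) = I3 (pcop R t).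
Proof.
rewrite tensor1U /coprodr lextU fcopU [pcop R (tree_val _)]pcop_canon.
exact: erefl.
Qed.

Lemma coprodl_unit t : coprodl (tensor 1 (tvec R t)) = I3 (tensor 1 (tvec R t)).
Proof.
rewrite tensor1U /coprodl /I3 [RHS]lextU [LHS]lextU fcop1.
exact: lextU.
Qed.

(** Induction on the tree: both iterated coproducts are algebra morphisms, hence agree on the
    product over the children. The term that [coprodl] produces under B_+ is the one that [coprodr]
    produces from 1 (x) t. *)
Lemma pcop_coassoc t : coprodl (pcop R t) = coprodr (pcop R t).
Proof.
elim/ptree_ind_in: t => i ts IH.
have {IH}IH : coprodl (\prod_(t <- ts) pcop R t) = coprodr (\prod_(t <- ts) pcop R t).
  rewrite !morph_prod_seq;
    [|exact: coprodr1|exact: coprodrM|exact: coprodl1|exact: coprodlM].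
  apply: eq_big_seq => t tts.
  exact: IH.
have E := coprodr_pcop_unit (PNode i ts); move: E; rewrite pcopE.
move: (\prod_(t <- ts) pcop R t) IH => x IH E.
rewrite -/(BL i x) in E *; rewrite [LHS]linearD [RHS]linearD /= E coprodl_unit.
rewrite [coprodl (BL i x)]coprodl_BplusL [coprodr (BL i x)]coprodr_BplusL IH.
have L : {morph I3 : y z / y + z} by move=> y z; apply: linearD.
by rewrite L addrA.
Qed.

Lemma fcop_coassoc (f : F) : coprodl (fcop R f) = coprodr (fcop R f).
Proof.
rewrite fcop_prod !morph_prod_seq;
  [|exact: coprodr1|exact: coprodrM|exact: coprodl1|exact: coprodlM].
by apply: eq_bigr => t _; apply: pcop_coassoc.
Qed.

Definition counit (f : F) : R^o := (f == mone)%:R.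

(** Convolution without truncation, on functions of all forests: the algebra laws are proved here
    first, where no node bound interferes. *)
Definition fstar X Y (f : F) : R^o :=
  lext (fun p => X p.1 * Y p.2 : R^o) (fcop R f).

Lemma fstarA X Y Z : fstar (fstar X Y) Z =1 fstar X (fstar Y Z).
Proof.
move=> f; pose XYZ (r : F * (F * F)) : R^o := X r.1 * (Y r.2.1 * Z r.2.2).
transitivity (lext XYZ (coprodl (fcop R f))); last first.
  rewrite fcop_coassoc /coprodr lext_lext; apply: eq_lext => p _.
  rewrite lext_lext [RHS](scale_lext (X p.1) (fun q => Y q.1 * Z q.2 : R^o)).
  by apply: eq_lext => q _; rewrite lextU.
rewrite /coprodl lext_lext; apply: eq_lext => p _.
rewrite lext_lext [LHS]mulrC.
rewrite [LHS](scale_lext (Z p.2) (fun q => X q.1 * Y q.2 : R^o)).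
apply: eq_lext => q _; rewrite lextU /XYZ /=.
by rewrite [LHS]mulrC mulrA.
Qed.

Lemma counitM : {morph counit : f g / mmul f g >-> f * g}.
Proof. by move=> f g; rewrite /counit cmM_eq1 -mulnb natrM. Qed.

Lemma counit1 : counit mone = 1.
Proof. by rewrite /counit eqxx. Qed.

Lemma counitU t : counit (ucm t) = 0.
Proof. by rewrite /counit cm1_eq1. Qed.

Lemma fvec_prod (f : F) : fvec R f = \prod_(t <- melems f) tvec R t.
Proof.
rewrite {1}(forest_prod f).
by elim/big_rec2: _ => [//|t x y _ <-]; rewrite fvecM.
Qed.

Definition counitl : BCK2 R d -> BCK R d :=
  lext (fun p => counit p.1 *: fvec R p.2).

Definition counitr : BCK2 R d -> BCK R d :=
  lext (fun p => counit p.2 *: fvec R p.1).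

Lemma counitlM : {morph counitl : x y / x * y}.
Proof.
apply: lextM => p q /=.
by rewrite counitM -fvecM -scalerAl -scalerAr scalerA.
Qed.

Lemma counitrM : {morph counitr : x y / x * y}.
Proof.
apply: lextM => p q /=.
by rewrite counitM -fvecM -scalerAl -scalerAr scalerA.
Qed.

Lemma counitl1 : counitl 1 = 1.
Proof. by rewrite /counitl lextU /= counit1 scale1r. Qed.

Lemma counitr1 : counitr 1 = 1.
Proof. by rewrite /counitr lextU /= counit1 scale1r. Qed.

(** Both sides are multiplicative, so a single tree suffices: the terms under B_+ have a non-empty
    left factor, and only 1 (x) t survives. *)
Lemma counitl_fcop f : counitl (fcop R f) = fvec R f.
Proof.
rewrite fcop_prod morph_prod_seq; [|exact: counitl1|exact: counitlM].
rewrite fvec_prod; apply: eq_bigr => t _; rewrite -[in RHS](mktreeK t).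
case: (tree_val t) => i ts; rewrite pcopE tensor1U tensor_map_BplusL /counitl.
rewrite linearD /= lextU /= counit1 scale1r lext_lext.
rewrite (eq_lext (h := fun=> 0)); last first.
  by move=> p _; rewrite lextU /= counitU scale0r.
by rewrite /lext big1 ?addr0 // => p _; rewrite scaler0.
Qed.

(** Nodes are compared through the sorted list of their canonical children, so it is enough that the
    multisets of canonical children agree. *)
Lemma Bplus_mktree i (ts : seq (ptree 'I_d.+1)) :
  Bplus i (\big[mmul/mone]_(t <- ts) ucm (mktree t)) = mktree (PNode i ts).
Proof.
apply/mktreeP/canonP => /=; congr PNode; apply/perm_sortP.
- exact: ple_total.
- exact: ple_trans.
- exact: ple_anti.
have -> : map (@Defs.canon _) ts =
    map (@Defs.canon _) (map (@tree_val d) (map (@mktree d) ts)).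
  by rewrite -!map_comp; apply: eq_map => t /=; rewrite canonK.
do 2!apply: perm_map; elim: ts => [|t ts IH] /=; first by rewrite big_nil melems1.
rewrite big_cons (perm_trans (perm_melemsM _ _)) // melemsU.
by rewrite perm_cons.
Qed.

(** Here 1 (x) t is the term that is killed; the remaining one is B_+ applied to the product over
    the children, known by induction. *)
Lemma counitr_pcop t : counitr (pcop R t) = tvec R (mktree t).
Proof.
elim/ptree_ind_in: t => i ts IH.
rewrite pcopE tensor1U tensor_map_BplusL /counitr linearD /= lextU /= counitU.
rewrite scale0r add0r lext_lext.
set x := \prod_(t <- ts) _.
have Ex : counitr x = fvec R (\big[mmul/mone]_(t <- ts) ucm (mktree t)).
  rewrite morph_prod_seq; [|exact: counitr1|exact: counitrM].
  rewrite big_seq [in RHS]big_seq.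
  by elim/big_rec2: _ => [//|t f y tts ->]; rewrite IH // fvecM.
transitivity (lext (fun f => tvec R (Bplus i f)) (counitr x)); last first.
  by rewrite Ex -Bplus_mktree; apply: lextU.
rewrite /counitr lext_lext.
by apply: eq_lext => p _; rewrite lextU linearZ /= lextU.
Qed.

Lemma counitr_fcop f : counitr (fcop R f) = fvec R f.
Proof.
rewrite fcop_prod morph_prod_seq; [|exact: counitr1|exact: counitrM].
rewrite fvec_prod; apply: eq_bigr => t _.
by rewrite counitr_pcop mktreeK.
Qed.

Lemma fstar_counitl X : fstar counit X =1 X.
Proof.
move=> f; transitivity (lext X (counitl (fcop R f))); last first.
  by rewrite counitl_fcop; apply: lextU.
by rewrite lext_lext; apply: eq_lext => p _; rewrite linearZ /= lextU.
Qed.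

Lemma fstar_counitr X : fstar X counit =1 X.
Proof.
move=> f; transitivity (lext X (counitr (fcop R f))); last first.
  by rewrite counitr_fcop; apply: lextU.
rewrite lext_lext; apply: eq_lext => p _.
by rewrite linearZ /= lextU; apply: mulrC.
Qed.

End Coassociativity.

(** * The convolution algebra *)

Section Grading.
Context (R : realType) (d : nat) (gamma : R).

Definition homog2 (c : R) (x : BCK2 R d) :=
  forall p, p \in msupp x -> fweight gamma p.1 + fweight gamma p.2 = c.

Lemma homog2_prod (I : eqType) (s : seq I) (F : I -> BCK2 R d) c :
  {in s, forall t, homog2 (c t) (F t)} ->
  homog2 (\sum_(t <- s) c t) (\prod_(t <- s) F t).
Proof.
elim: s => [|t s IH] H p.
  rewrite !big_nil msuppU oner_eq0 inE => /eqP -> /=.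
  by rewrite fweight1 addr0.
rewrite !big_cons => /msuppM_le[a [b [at_ bs ->]]] /=.
rewrite !fweightM addrACA (H t) ?mem_head // IH // => u us.
by apply: H; rewrite in_cons us orbT.
Qed.

(** Induction on the tree: the root is put back with its decoration on the left factor by B_+, so no
    weight is lost. *)
Lemma homog2_pcop t : homog2 (pweight gamma t) (pcop R t).
Proof.
elim/ptree_ind_in: t => i ts IH p; rewrite pcopE => /(fsubsetP (msuppD_le _ _)).
rewrite in_fsetU => /orP[|].
  rewrite tensor1U msuppU oner_eq0 inE => /eqP -> /=.
  by rewrite fweight1 add0r fweightU /tweight -/(pweight _ _) pweight_canon.
rewrite tensor_map_BplusL => /msupp_lext[q qx].
rewrite msuppU oner_eq0 inE => /eqP -> /=.
rewrite fweightU tweight_Bplus -addrA pweight_node; congr (_ + _).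
exact: (@homog2_prod _ _ (pcop R (d := d)) _ IH _ qx).
Qed.

Lemma homog2_fcop f : homog2 (fweight gamma f) (fcop R f).
Proof.
rewrite fcop_prod.
apply: (@homog2_prod _ _ (fun t => pcop R (tree_val t)) (tweight gamma)).
by move=> t _; apply: homog2_pcop.
Qed.

End Grading.

Lemma fnodes_fcop (R : realType) d (f : forest d) p :
  p \in msupp (fcop R f) -> (fnodes p.1 + fnodes p.2 = fnodes f)%N.
Proof.
move=> /(@homog2_fcop _ _ 1); rewrite !fweight_fnodes -natrD => /eqP.
by rewrite eqr_nat => /eqP.
Qed.

Lemma fnodesM d (f g : forest d) : fnodes (mmul f g) = (fnodes f + fnodes g)%N.
Proof. by rewrite !fnodes_melems (perm_big _ (perm_melemsM f g)) big_cat. Qed.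

Lemma fnodes1 d : fnodes (mone : forest d) = 0%N.
Proof. by rewrite fnodes_melems melems1 big_nil. Qed.

Lemma fnodesU d (t : tree d) : fnodes (ucm t) = tnodes t.
Proof. by rewrite fnodes_melems melemsU big_seq1. Qed.

(** * Convolution on the dual truncated at [N] nodes *)

Section DualAlgebra.
Context (R : realType) (d N : nat).
Local Notation F := (forest d).
Local Notation dual := (dual R d N).
Local Notation "1^*" := (dunit R (d := d) (N := N)).
Implicit Types (X Y Z : dual) (f g : F).

Lemma dvalE X (f : forestN d N) : dval X (val f) = X f.
Proof. by rewrite /dval valK. Qed.

Lemma dval_out X f : (N < fnodes f)%N -> dval X f = 0.
Proof. by move=> Nf; rewrite /dval insubF // leqNgt Nf. Qed.

Lemma dvalP X Y :
  (forall f, (fnodes f <= N)%N -> dval X f = dval Y f) -> X = Y.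
Proof.
by move=> E; apply: functional_extensionality_dep => f; rewrite -!dvalE E ?(valP f).
Qed.

Lemma dval0 f : dval (0 : dual) f = 0.
Proof. by rewrite /dval; case: insub. Qed.

Lemma dval_is_linear f : linear (fun X => dval X f).
Proof.
move=> c X Y /=; have [le|gt] := leqP (fnodes f) N.
  by rewrite /dval !insubT.
by rewrite !dval_out // scaler0 addr0.
Qed.
Lemma dval_fun (phi : F -> R) f : (fnodes f <= N)%N ->
  dval (fun g : forestN d N => phi (val g)) f = phi f.
Proof. by move=> le; rewrite /dval insubT. Qed.

(** By the grading, a convolution at [f] sees only forests with at most as many nodes. This makes
    truncation compatible with convolution. *)
Lemma eq_fstar (X X' Y Y' : F -> R^o) f :
  (forall g, (fnodes g <= fnodes f)%N -> X g = X' g) ->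
  (forall g, (fnodes g <= fnodes f)%N -> Y g = Y' g) ->
  fstar X Y f = fstar X' Y' f.
Proof.
move=> EX EY; apply: eq_lext => p /fnodes_fcop E.
by rewrite EX ?EY // -E ?leq_addl ?leq_addr.
Qed.

Lemma dval_star X Y f : (fnodes f <= N)%N ->
  dval (star X Y) f = fstar (dval X) (dval Y) f.
Proof.
move=> le; rewrite /star; rewrite (dval_fun (fun f => dpair2 X Y (coprod (fvec R f)))) //.
by rewrite coprod_fvec.
Qed.

Lemma dval_dunit f : (fnodes f <= N)%N -> dval 1^* f = counit R f.
Proof. exact: (dval_fun (counit R (d := d))). Qed.

Lemma dval_as_dual (x : BCK R d) f : (fnodes f <= N)%N ->
  dval (as_dual x : dual) f = x@_f.
Proof. exact: (dval_fun (fun f => x@_f)). Qed.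

Lemma starA X Y Z : star (star X Y) Z = star X (star Y Z).
Proof.
apply: dvalP => f le; rewrite !dval_star //.
rewrite (eq_fstar (X' := fstar (dval X) (dval Y)) (Y' := dval Z)) //; last first.
  by move=> g gf; rewrite dval_star // (leq_trans gf).
rewrite fstarA; apply: eq_fstar => // g gf.
by rewrite dval_star // (leq_trans gf).
Qed.

Lemma star1X X : star 1^* X = X.
Proof.
apply: dvalP => f le; rewrite dval_star //.
rewrite (eq_fstar (X' := @counit R d) (Y' := dval X)) ?fstar_counitl //.
by move=> g gf; rewrite dval_dunit // (leq_trans gf).
Qed.

Lemma starX1 X : star X 1^* = X.
Proof.
apply: dvalP => f le; rewrite dval_star //.
rewrite (eq_fstar (Y' := @counit R d) (X' := dval X)) ?fstar_counitr //.
by move=> g gf; rewrite dval_dunit // (leq_trans gf).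
Qed.

Lemma star_linearl Y : linear (fun X => star X Y).
Proof.
move=> c X X'; apply: dvalP => f le; rewrite [RHS]dval_is_linear /= !dval_star //.
rewrite /fstar [X in _ = X + _](scale_lext c (fun p => dval X p.1 * dval Y p.2 : R^o)).
rewrite -lext_add; apply: eq_lext => p _.
by rewrite dval_is_linear mulrDl -scalerAl.
Qed.

Lemma star_linearr X : linear (star X).
Proof.
move=> c Y Y'; apply: dvalP => f le; rewrite [RHS]dval_is_linear /= !dval_star //.
rewrite /fstar [X in _ = X + _](scale_lext c (fun p => dval X p.1 * dval Y p.2 : R^o)).
rewrite -lext_add; apply: eq_lext => p _.
by rewrite dval_is_linear mulrDr -scalerAr.
Qed.

End DualAlgebra.

Lemma lext_neq0 (R : comNzRingType) (K : choiceType) (V : lmodType R)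
    (g : K -> V) (x : {malg R[K]}) :
  lext g x != 0 -> exists2 k, k \in msupp x & g k != 0.
Proof.
move=> nz; apply: contrapT => H; case/negP: nz; apply/eqP.
rewrite /lext big1_seq // => k /= kx.
have [->|gk] := eqVneq (g k) 0; first by rewrite scaler0.
by case: H; exists k.
Qed.

(** * Words, their functionals, and multiplicativity of [Psi] *)

Section Words.
Context (R : realType) (d N : nat) (tau : nat -> BCK R d) (deg deg0 : nat -> nat).
Context (tauP : FC_basis N tau deg deg0).
Local Notation F := (forest d).
Local Notation TN := (TN R N deg).
Local Notation starL := (@starL R d N deg tau).
Local Notation Psi := (@Psi R d N deg tau).
Local Notation starw := (@starw R d N tau).
Local Notation wdeg := (wdeg deg).
Implicit Types (u v w : seq nat) (f g : F) (X Y : TN).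

Lemma wdeg_cons i w : wdeg (i :: w) = (deg i + wdeg w)%N.
Proof. exact: big_cons. Qed.

Lemma wdeg_nil : wdeg [::] = 0%N.
Proof. exact: big_nil. Qed.

Lemma wweight_wdeg w : wweight 1 deg deg0 w = (wdeg w)%:R :> R.
Proof.
rewrite /wweight /Defs.wdeg natr_sum; apply: eq_bigr => i _.
by rewrite /weight subrr mul0r add0r mul1r.
Qed.

(** The functional of a word before truncation; defined on all forests, it has a support that can be
    described without a bound. *)
Definition fstarw w : F -> R^o :=
  foldr (@fstar R d) (@counit R d) [seq (fun f => (tau i)@_f : R^o) | i <- w].

Lemma dval_starw w f : (fnodes f <= N)%N -> dval (starw w) f = fstarw w f.
Proof.
elim: w f => [|i w IH] f le /=; first exact: dval_dunit.
rewrite dval_star //; apply: eq_fstar => g gf.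
  by rewrite dval_as_dual // (leq_trans gf).
by rewrite IH // (leq_trans gf).
Qed.

(** The coproduct preserves weight and each tau_i lives on trees of one weight, so weights add along
    the convolution product. *)
Lemma fstarw_weight (gamma : R) w f :
  fstarw w f != 0 -> fweight gamma f = wweight gamma deg deg0 w.
Proof.
elim: w f => [|i w IH] f /=.
  rewrite /fstarw /= /counit; have [->|_] := eqVneq f mone; last by rewrite eqxx.
  by rewrite fweight1 /wweight big_nil.
case/lext_neq0 => p /(@homog2_fcop _ _ gamma) <-.
rewrite mulf_eq0 negb_or => /andP[+ /IH ->].
rewrite mcoeff_neq0 => /(FC_tree tauP)[t [-> degt deg0t]].
by rewrite fweightU /tweight degt deg0t /wweight big_cons.
Qed.

Lemma fstarw_fnodes w f : fstarw w f != 0 -> fnodes f = wdeg w.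
Proof.
move=> /(fstarw_weight 1); rewrite fweight_fnodes wweight_wdeg => /eqP.
by rewrite eqr_nat => /eqP.
Qed.

Lemma starL_wvec w : starL (wvec w) = starw w.
Proof.
rewrite /wvec; have [le|gt] := leqP (wdeg w) N.
  by rewrite insubT [LHS]lextU.
(* Beyond the bound [wvec w] is 0 by default, and the convolution product vanishes too: its support
   lies on forests with more than [N] nodes. *)
rewrite insubF; last by rewrite leqNgt gt.
rewrite [oapp _ _ _]/= (raddf0 starL); apply: dvalP => f le.
rewrite dval_starw // dval0.
have [//|/fstarw_fnodes E] := eqVneq (fstarw w f) 0.
by rewrite E leqNgt gt in le.
Qed.

Lemma starw_cat u v : starw (u ++ v) = star (starw u) (starw v).
Proof.
elim: u => [|i u IH]; first by rewrite star1X.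
by rewrite [RHS]starA -IH.
Qed.

Lemma starw1 i : starw [:: i] = as_dual (tau i).
Proof. exact: starX1. Qed.

Lemma starL_concat X Y : starL (concat X Y) = star (starL X) (starL Y).
Proof.
rewrite [concat X Y]/concat (linear_lext starL).
rewrite [RHS](linear_lextP _ _ (star_linearl (starL Y))).
apply: eq_lext => u _ /=; rewrite (linear_lext starL).
rewrite (linear_lextP _ _ (star_linearr (starw (val u)))).
by apply: eq_lext => v _ /=; rewrite starL_wvec starw_cat.
Qed.

Lemma Psi_star (X Y : dual R d N) : Psi (star X Y) = concat (Psi X) (Psi Y).
Proof.
apply: (can_inj (starLK tauP)).
by rewrite starL_concat !(PsiK tauP).
Qed.

Lemma linear_wvec_eq (V : lmodType R) (g h : {linear TN -> V}) :
  (forall w, (wdeg w <= N)%N -> g (wvec w) = h (wvec w)) -> g =1 h.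
Proof.
move=> E X; rewrite (lext_uniq g) (lext_uniq h); apply: eq_lext => u _.
by have := E (val u) (valP u); rewrite /wvec valK.
Qed.

End Words.

(** * The adjoint of M *)

Lemma fvec1 (R : comNzRingType) d : fvec R (mone : forest d) = 1.
Proof. exact: erefl. Qed.

Lemma msupp_one (R : comNzRingType) d : msupp (1 : BCK R d) = [fset mone]%fset.
Proof. exact: msuppU1. Qed.

Lemma lext_tensor (R : comNzRingType) d (X Y : forest d -> R^o) (x y : BCK R d) :
  lext (fun p => X p.1 * Y p.2 : R^o) (tensor x y) = lext X x * lext Y y.
Proof.
rewrite lext_lext [RHS]mulrC [RHS](scale_lext (lext Y y : R) X x).
apply: eq_lext => f _; rewrite lext_lext [RHS]mulrC [RHS](scale_lext (X f : R) Y y).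
by apply: eq_lext => g _; rewrite lextU.
Qed.

Section Adjoint.
Context (R : realType) (d N : nat) (gamma : R).
Context (M : {linear BCK R d -> BCK R d}).
Context (M_mul : forall x y, M (x * y) = M x * M y) (M_one : M 1 = 1).
Context (M_coprod : forall x, tensor_map M M (coprod x) = coprod (M x)).
Context (M_tree : forall (t : tree d) f, f \in msupp (M (tvec R t)) ->
  exists t' : tree d, [/\ f = ucm t',
    tweight gamma t <= tweight gamma t' & (tnodes t' <= tnodes t)%N]).
Local Notation F := (forest d).
Local Notation dual := (dual R d N).
Implicit Types (X Y : dual) (f g : F).

(** Induction on the trees of the forest: [M] is multiplicative, and weights and node numbers are
    additive. *)
Lemma M_forest f g : g \in msupp (M (fvec R f)) ->
  fweight gamma f <= fweight gamma g /\ (fnodes g <= fnodes f)%N.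
Proof.
elim/forest_ind: f g => [|t f IH] g.
  rewrite fvec1 M_one msupp_one in_fset1 => /eqP ->.
  by rewrite lexx leqnn.
rewrite -fvecM M_mul => /msuppM_le[a [b [/M_tree[t' [-> wt nt]] /IH[wf nf] ->]]].
by rewrite !fweightM !fnodesM !fweightU !fnodesU lerD ?leq_add.
Qed.

(** [M] sends trees to combinations of trees, never to the empty forest, so it preserves the
    augmentation; dually M^* fixes the unit. *)
Lemma counit_M f : lext (@counit R d) (M (fvec R f)) = counit R f.
Proof.
elim/forest_ind: f => [|t f IH]; first by rewrite fvec1 M_one; apply: lextU.
rewrite -fvecM M_mul counitM counitU.
rewrite mul0r (lextM (@counitM R d)) [X in X * _](_ : _ = 0).
  exact: mul0r.
rewrite /lext big1_seq // => a /= /M_tree[t' [-> _ _]].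
by rewrite counitU scaler0.
Qed.

Lemma dval_adjoint X f : (fnodes f <= N)%N ->
  dval (adjoint M X) f = lext (dval X) (M (fvec R f)).
Proof. exact: (dval_fun (fun f => lext (dval X) (M (fvec R f)))). Qed.

Lemma adjoint_linear : linear (@adjoint R d N M).
Proof.
move=> c X Y; apply: dvalP => f le; rewrite [RHS]dval_is_linear /= !dval_adjoint //.
rewrite scale_lext -lext_add; apply: eq_lext => g _.
by rewrite dval_is_linear.
Qed.

Lemma adjoint_dunit : adjoint M (dunit R (N := N)) = dunit R (N := N).
Proof.
apply: dvalP => f le; rewrite dval_adjoint // dval_dunit // -counit_M.
apply: eq_lext => g /M_forest[_ gf]; rewrite dval_dunit //.
exact: leq_trans gf le.
Qed.

(** This is (M (x) M) Delta = Delta M read on functionals; [M_forest] and the grading keep every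
    forest that occurs within the node bound. *)
Lemma adjoint_star X Y :
  adjoint M (star X Y) = star (adjoint M X) (adjoint M Y).
Proof.
apply: dvalP => f le; rewrite dval_star // dval_adjoint //.
pose XY (p : F * F) : R^o := dval X p.1 * dval Y p.2.
transitivity (lext XY (coprod (M (fvec R f)))).
  rewrite lext_lext; apply: eq_lext => g /M_forest[_ gf].
  by rewrite dval_star // (leq_trans gf le).
rewrite -M_coprod coprod_fvec lext_lext; apply: eq_lext => p /fnodes_fcop E.
rewrite lext_tensor !dval_adjoint //; apply: leq_trans le.
  by rewrite -E leq_addl.
by rewrite -E leq_addr.
Qed.

(** Characters of the forest algebra seen through the truncation: the counterpart in H_N^* of
    shuffle characters. *)
Definition multiplicative_upto (X : dual) :=
  dval X mone = 1 /\ forall f g, (fnodes f + fnodes g <= N)%N ->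
    dval X (mmul f g) = dval X f * dval X g.

Lemma adjoint_multiplicative X :
  multiplicative_upto X -> multiplicative_upto (adjoint M X).
Proof.
case=> X1 XM; split.
  rewrite dval_adjoint ?fnodes1 // fvec1 M_one -[RHS]X1.
  exact: lextU.
move=> f g le; rewrite !dval_adjoint ?fnodesM //.
- rewrite -fvecM M_mul; apply: lextM_in => a b /M_forest[_ af] /M_forest[_ bg].
  by apply: XM; apply: leq_trans le; apply: leq_add.
- exact: leq_trans (leq_addl _ _) le.
- exact: leq_trans (leq_addr _ _) le.
Qed.

End Adjoint.

(** * Finiteness of the set of words *)

Section Finiteness.

Fixpoint seqs_upto (T : Type) (s : seq T) n : seq (seq T) :=
  if n is n'.+1 then [::] :: [seq x :: w | x <- s, w <- seqs_upto s n']
  else [:: [::]].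

Lemma mem_seqs_upto (T : eqType) (s : seq T) n w :
  (size w <= n)%N -> {subset w <= s} -> w \in seqs_upto s n.
Proof.
elim: n w => [|n IH] [|x w] // le sub.
rewrite [seqs_upto _ _]/= in_cons; apply/allpairsP; exists (x, w); split=> //=.
  by apply: sub; rewrite mem_head.
by apply: IH => // y yw; apply: sub; rewrite in_cons yw orbT.
Qed.

Lemma leq_size_sum (T : eqType) (h : T -> nat) (s : seq T) :
  {in s, forall x, 0 < h x}%N -> (size s <= \sum_(x <- s) h x)%N.
Proof.
move=> hgt; rewrite -sum1_size big_seq [leqRHS]big_seq.
exact: leq_sum.
Qed.

Lemma leq_mem_sum (T : eqType) (h : T -> nat) (s : seq T) x :
  x \in s -> (h x <= \sum_(y <- s) h y)%N.
Proof. by move=> xs; rewrite (big_rem x) //= leq_addr. Qed.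

Context (d : nat).

Fixpoint ptrees_upto n : seq (ptree 'I_d.+1) :=
  if n is n'.+1 then
    [seq PNode a ts | a <- enum 'I_d.+1, ts <- seqs_upto (ptrees_upto n') n']
  else [::].

Lemma mem_ptrees_upto n t : (pnodes t <= n)%N -> t \in ptrees_upto n.
Proof.
elim: n t => [|n IH] [a ts] //=; rewrite sumnE big_map ltnS => le.
apply/allpairsP; exists (a, ts); split=> //=; first by rewrite mem_enum.
apply: mem_seqs_upto => [|t tts].
  by apply: leq_trans le; apply: leq_size_sum => -[].
by apply: IH; apply: leq_trans le; apply: leq_mem_sum.
Qed.

Context (R : realType) (N : nat) (tau : nat -> BCK R d) (deg deg0 : nat -> nat).
Context (tauP : FC_basis N tau deg deg0).

(** Freeness excludes tau_i = 0, so some tree lies in its support, and trees are non-empty. *)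
Lemma deg_gt0 i : (0 < deg i)%N.
Proof.
have [tau0|[f /(FC_tree tauP)[t [_ <- _]]]] := fset_0Vmem (msupp (tau i)).
  have : << i >> = 0 :> {malg R[nat]}.
    apply: (FC_free tauP); rewrite lextU (malg_basis (tau i)) tau0.
    exact: big_seq_fset0.
  by move/eqP; rewrite monalgU_eq0 oner_eq0.
exact: tnodes_gt0.
Qed.

(** A span of k forests cannot contain k + 1 free vectors: a dependence is read off the left kernel
    of the coefficient matrix, which has more rows than columns. *)
Lemma tau_dependent (D : seq (forest d)) (k := size D) :
  ~ forall i, (i <= k)%N -> {subset msupp (tau i) <= D}.
Proof.
move=> sub; pose A := \matrix_(i < k.+1, j < k) (tau i)@_(nth mone D j).
have : kermx A != 0.
  rewrite -mxrank_eq0 mxrank_ker subn_eq0 -ltnNge ltnS.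
  exact: rank_leq_col.
case/rowV0Pn=> v /sub_kermxP vA; case/negP; apply/eqP/rowP => i; rewrite mxE.
pose c : {malg R[nat]} := \sum_(j < k.+1) v 0 j *: << (j : nat) >>.
have cE (j : 'I_k.+1) : c@_(j : nat) = v 0 j.
  rewrite raddf_sum (bigD1 j) //= big1 => [|l lj]; rewrite mcoeffZ mcoeffU.
    by rewrite eqxx mulr1 addr0.
  by rewrite -[_ == _ :> nat]/(l == j) (negPf lj) mulr0.
rewrite -cE (FC_free tauP (c := c)) ?mcoeff0 //.
rewrite linear_sum /=.
have -> : \sum_(j < k.+1) lext tau (v 0 j *: << (j : nat) >>) =
    \sum_(j < k.+1) v 0 j *: tau j.
  by apply: eq_bigr => j _; rewrite linearZ /= lextU.
apply/malgP => f; rewrite raddf_sum mcoeff0 /=.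
have [fD|fD] := boolP (f \in D); last first.
  rewrite big1 // => j _; rewrite mcoeffZ mcoeff_outdom ?mulr0 //.
  by apply: contra fD; apply: sub; rewrite -ltnS.
have lt : (index f D < k)%N by rewrite index_mem.
have := congr1 (fun B : 'rV_k => B 0 (Ordinal lt)) vA; rewrite !mxE => E.
rewrite -[RHS]E; apply: eq_bigr => j _.
by rewrite mxE /= nth_index // mcoeffZ.
Qed.

(** If some tau_i of degree at most [N] had an index above the size of the list of trees with at
    most [N] nodes, monotonicity of degrees would put all earlier tau_j in the span of that list,
    against [tau_dependent]. *)
Lemma deg_unbounded : exists n, forall i, (deg i <= N)%N -> (i < n)%N.
Proof.
pose D : seq (forest d) := [seq ucm (mktree t) | t <- ptrees_upto N].
exists (size D).+1 => i le; rewrite ltnS leqNgt; apply/negP => lt.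
apply: (@tau_dependent D) => j jD f /(FC_tree tauP)[t [-> degt _]].
rewrite -(mktreeK t); apply/mapP; exists (tree_val t) => //.
apply: mem_ptrees_upto; rewrite -/(tnodes t) degt (leq_trans _ le) //.
by rewrite (FC_mono tauP) // (leq_trans jD) // ltnW.
Qed.

(** Letters have positive degree, so a word within the bound has at most [N] letters, taken from a
    finite alphabet. *)
Lemma words_finite : exists2 W : seq (seq nat), uniq W &
  forall w, (w \in W) = (wdeg deg w <= N)%N.
Proof.
have [n degn] := deg_unbounded.
exists (undup [seq w <- seqs_upto (iota 0 n) N | (wdeg deg w <= N)%N]).
  exact: undup_uniq.
move=> w; rewrite mem_undup mem_filter; case: leqP => //= le.
apply: mem_seqs_upto => [|i iw].
  by apply: leq_trans le; apply: leq_size_sum => i _; apply: deg_gt0.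
rewrite mem_iota add0n; apply: degn; apply: leq_trans le.
exact: leq_mem_sum.
Qed.

End Finiteness.

(** * Duality between shuffles and the forest product *)

(** All splittings of a word into two complementary subwords, with multiplicity: the coproduct for
    which letters are primitive. *)
Fixpoint unshuffle (T : Type) (w : seq T) : seq (seq T * seq T) :=
  if w is i :: w' then
    [seq (i :: p.1, p.2) | p <- unshuffle w']
    ++ [seq (p.1, i :: p.2) | p <- unshuffle w']
  else [:: ([::], [::])].

Lemma shuffles0 u : shuffle u [::] = [:: u].
Proof. by case: u. Qed.

Lemma shuffle_cons a u b v : shuffle (a :: u) (b :: v) =
  map (cons a) (shuffle u (b :: v)) ++ map (cons b) (shuffle (a :: u) v).
Proof. by []. Qed.

Lemma count_cons_map (T : eqType) (c a : T) w (s : seq (seq T)) :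
  count_mem (c :: w) (map (cons a) s) = ((a == c) * count_mem w s)%N.
Proof.
rewrite count_map; have [->|ac] := eqVneq a c; last first.
  rewrite mul0n -(count_pred0 s); apply: eq_count => x /=.
  by rewrite eqseq_cons (negPf ac).
by rewrite mul1n; apply: eq_count => x /=; rewrite eqseq_cons eqxx.
Qed.

(** Shuffle product and unshuffle coproduct are dual: in both counts the first letter of [w] is the
    first letter of [u] or that of [v]. *)
Lemma count_shuffle u v w :
  count_mem w (shuffle u v) = count_mem (u, v) (unshuffle w).
Proof.
elim: w u v => [|c w IH] u v.
  have nilP a s : count_mem [::] (map (cons a) s) = 0%N by elim: s.
  case: u v => [|a u] [|b v] //.
  by rewrite shuffle_cons count_cat !nilP.
rewrite /= count_cat !count_map.
(* [El] counts the splittings that give the first letter [c] to the left part, [Er] those that give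
   it to the right part. *)
have El : count (preim (fun p => (c :: p.1, p.2)) (pred1 (u, v))) (unshuffle w)
    = if u is a :: u' then ((a == c) * count_mem (u', v) (unshuffle w))%N else 0%N.
  case: u => [|a u].
    by rewrite -(count_pred0 (unshuffle w)); apply: eq_count => -[].
  have [->|ac] := eqVneq a c.
    by rewrite mul1n; apply: eq_count => -[x y] /=; rewrite !xpair_eqE eqseq_cons eqxx.
  rewrite mul0n -(count_pred0 (unshuffle w)); apply: eq_count => -[x y] /=.
  by rewrite !xpair_eqE eqseq_cons [c == a]eq_sym (negPf ac).
have Er : count (preim (fun p => (p.1, c :: p.2)) (pred1 (u, v))) (unshuffle w)
    = if v is b :: v' then ((b == c) * count_mem (u, v') (unshuffle w))%N else 0%N.
  case: v {El} => [|b v].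
    rewrite -(count_pred0 (unshuffle w)); apply: eq_count => -[x y] /=.
    by rewrite xpair_eqE andbF.
  have [->|bc] := eqVneq b c.
    by rewrite mul1n; apply: eq_count => -[x y] /=; rewrite !xpair_eqE eqseq_cons eqxx.
  rewrite mul0n -(count_pred0 (unshuffle w)); apply: eq_count => -[x y] /=.
  by rewrite !xpair_eqE eqseq_cons [c == b]eq_sym (negPf bc) andbF.
rewrite El Er {El Er}.
case: u v => [|a u] [|b v] //.
- by rewrite -IH /= eqseq_cons !addn0 mulnb.
- by rewrite -IH !shuffles0 /= eqseq_cons !addn0 mulnb.
- by rewrite shuffle_cons count_cat !count_cons_map !IH.
Qed.

Lemma wdeg_unshuffle deg w p : p \in unshuffle w ->
  (wdeg deg p.1 + wdeg deg p.2 = wdeg deg w)%N.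
Proof.
elim: w p => [|i w IH] p /=; first by rewrite inE => /eqP ->; rewrite !wdeg_nil.
rewrite mem_cat => /orP[] /mapP[q /IH E ->] /=; rewrite !wdeg_cons -E ?addnA //.
by rewrite [(_ + deg i)%N]addnC.
Qed.

(** Regroups a sum over a list by multiplicity; the terms outside [D] must vanish, as coefficients
    beyond the degree bound do. *)
Lemma sum_count (R : pzRingType) (T : eqType) (s D : seq T) (G : T -> R) :
  uniq D -> (forall x, x \in s -> x \notin D -> G x = 0) ->
  \sum_(x <- s) G x = \sum_(x <- D) (count_mem x s)%:R * G x.
Proof.
move=> uD; elim: s => [|y s IH] H.
  by rewrite big_nil big1 // => x _; rewrite mul0r.
rewrite big_cons IH => [|x xs]; last by apply: H; rewrite in_cons xs orbT.
under [RHS]eq_bigr do rewrite /= natrD mulrDl.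
rewrite big_split /=; congr (_ + _).
have [yD|yD] := boolP (y \in D).
  rewrite (bigD1_seq y) //= eqxx mul1r big1 ?addr0 // => x xy.
  by rewrite eq_sym (negPf xy) mul0r.
rewrite H ?mem_head // big1_seq // => x /= xD.
by case: eqP => [yx|]; rewrite ?mul0r //; rewrite yx xD in yD.
Qed.

Section ShuffleDuality.
Context (R : realType) (d N : nat) (tau : nat -> BCK R d) (deg deg0 : nat -> nat).
Context (tauP : FC_basis N tau deg deg0).
Local Notation F := (forest d).
Local Notation TN := (TN R N deg).
Local Notation starL := (@starL R d N deg tau).
Local Notation Psi := (@Psi R d N deg tau).
Local Notation starw := (@starw R d N tau).
Local Notation wdeg := (wdeg deg).
Local Notation fstarw := (fstarw tau).
Local Notation eps := (@counit R d).
Implicit Types (u v w : seq nat) (f g : F) (X Y : TN).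

(** A product of two forests is a single tree only if one of them is empty, and tau_i is supported
    on single trees. *)
Lemma tau_primitive i f g :
  (tau i)@_(mmul f g) = (tau i)@_f * eps g + eps f * (tau i)@_g.
Proof.
have tau1 : (tau i)@_mone = 0.
  apply/mcoeff_outdom/negP => /(FC_tree tauP)[t [/(congr1 mdeg)]].
  by rewrite mdeg1 mdegU.
rewrite /counit; have [->|f1] := eqVneq f mone.
  by rewrite mul1m tau1 mul0r add0r mul1r.
have [->|g1] := eqVneq g mone; first by rewrite mulm1 tau1 mulr1 mulr0 addr0.
rewrite mulr0 mul0r addr0.
apply/mcoeff_outdom/negP => /(FC_tree tauP)[t [/(congr1 mdeg)]].
rewrite mdegM mdegU => E.
have f_gt0 : (0 < mdeg f)%N by rewrite lt0n mdeg_eq0.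
have g_gt0 : (0 < mdeg g)%N by rewrite lt0n mdeg_eq0.
by move: (leq_add f_gt0 g_gt0); rewrite E.
Qed.

(** Since Delta is an algebra morphism, the coproduct dual to the forest product is multiplicative
    for convolution; each letter being primitive, it goes to one factor or the other. *)
Lemma fstarwM w f g :
  fstarw w (mmul f g) =
  \sum_(p <- unshuffle w) fstarw p.1 f * fstarw p.2 g.
Proof.
elim: w f g => [|i w IH] f g.
  by rewrite big_seq1; apply: counitM.
pose T f : R^o := (tau i)@_f.
(* The flag tells whether the first letter acts on [f] (true) or on [g] (false); the other factor is
   convolved with the counit and simplifies. *)
pose s := [seq (true, p) | p <- unshuffle w] ++ [seq (false, p) | p <- unshuffle w].
pose g1 (bp : bool * (seq nat * seq nat)) (p : F * F) : R^o :=
  (if bp.1 then T else eps) p.1 * fstarw bp.2.1 p.2.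
pose g2 (bp : bool * (seq nat * seq nat)) (p : F * F) : R^o :=
  (if bp.1 then eps else T) p.1 * fstarw bp.2.2 p.2.
transitivity (\sum_(bp <- s) lext (g1 bp) (fcop R f) * lext (g2 bp) (fcop R g)).
  rewrite [LHS]/(fstar T (fstarw w) (mmul f g)) /fstar fcopM.
  apply: lextM_sum => a b _ _ /=; rewrite IH mulr_sumr /s big_cat !big_map /=.
  rewrite -big_split; apply: eq_bigr => p _ /=.
  by rewrite /T tau_primitive mulrDl; congr (_ + _); apply: mulrACA.
rewrite /s [unshuffle (i :: w)]/= !big_cat !big_map.
congr (_ + _); apply: eq_bigr => p _.
  by congr (_ * _); apply: fstar_counitl.
by congr (_ * _); apply: fstar_counitl.
Qed.

Lemma wvec_coef w (u : word N deg) : (wvec w : TN)@_u = (w == val u)%:R.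
Proof.
rewrite /wvec; case: insubP => [v _ <-|]; first by rewrite mcoeffU val_eqE.
by rewrite mcoeff0; case: eqP => // ->; rewrite (valP u).
Qed.

Lemma wcoef_val X (u : word N deg) : wcoef X (val u) = X@_u.
Proof. by rewrite /wcoef valK. Qed.

Lemma wcoef_out X w : (N < wdeg w)%N -> wcoef X w = 0.
Proof. by move=> lt; rewrite /wcoef insubF // leqNgt lt. Qed.

Context (W : seq (seq nat)) (uW : uniq W).
Context (memW : forall w, (w \in W) = (wdeg w <= N)%N).

Lemma wcoef_sum (b : seq nat -> R) (u : word N deg) :
  (\sum_(w <- W) b w *: wvec w : TN)@_u = b (val u).
Proof.
have coefD (Y Z : TN) : (Y + Z)@_u = Y@_u + Z@_u by apply: mcoeffD.
have coefZ c (Y : TN) : (c *: Y)@_u = c * Y@_u by apply: mcoeffZ.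
transitivity (\sum_(w <- W) b w * (w == val u)%:R).
  elim: (W) => [|w s IH]; first by rewrite !big_nil; apply: mcoeff0.
  by rewrite !big_cons coefD coefZ wvec_coef IH.
rewrite (bigD1_seq (val u)) ?memW ?(valP u) //= eqxx mulr1 big1 ?addr0 // => w wu.
by rewrite (negPf wu) mulr0.
Qed.

Lemma TN_expand X : X = \sum_(w <- W) wcoef X w *: wvec w.
Proof. by apply/malgP => u; rewrite wcoef_sum wcoef_val. Qed.

Lemma dval_sum (I : Type) (s : seq I) (b : I -> R) (Z : I -> dual R d N) f :
  dval (\sum_(i <- s) b i *: Z i) f = \sum_(i <- s) b i * dval (Z i) f.
Proof.
elim: s => [|i s IH]; first by rewrite !big_nil dval0.
by rewrite !big_cons dval_is_linear IH.
Qed.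

Lemma starL_sum (b : seq nat -> R) :
  starL (\sum_(w <- W) b w *: wvec w) = \sum_(w <- W) b w *: starw w.
Proof.
by rewrite linear_sum; apply: eq_bigr => w _; rewrite linearZ /= (starL_wvec tauP).
Qed.

Lemma dval_starL X f : (fnodes f <= N)%N ->
  dval (starL X) f = \sum_(w <- W) wcoef X w * fstarw w f.
Proof.
move=> le; rewrite {1}(TN_expand X) starL_sum dval_sum.
by apply: eq_bigr => w _; rewrite dval_starw.
Qed.

(** Injectivity of [starL], that is, uniqueness of the expansion in words, expressed through values
    at forests. *)
Lemma fstarw_free (b : seq nat -> R) :
  (forall f, (fnodes f <= N)%N -> \sum_(w <- W) b w * fstarw w f = 0) ->
  {in W, forall w, b w = 0}.
Proof.
move=> H w wW; pose X : TN := \sum_(w <- W) b w *: wvec w.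
have X0 : X = 0.
  apply: (can_inj (starLK tauP)); rewrite (raddf0 starL) starL_sum.
  apply: dvalP => f le; rewrite dval_sum dval0 -[RHS](H f le).
  by apply: eq_bigr => v _; rewrite dval_starw.
rewrite memW in wW; pose u : word N deg := exist _ w wW.
rewrite -[LHS](wcoef_sum b u) -/X X0.
exact: mcoeff0.
Qed.

Definition shuffle_coef X u v : R := \sum_(w <- shuffle u v) wcoef X w.

(** Each word [w] contributes to the pair (u, v) as often as it unshuffles into it, which is as
    often as it occurs in the shuffle of [u] and [v]. *)
Lemma dval_starLM X f g : (fnodes f + fnodes g <= N)%N ->
  dval (starL X) (mmul f g) =
  \sum_(u <- W) \sum_(v <- W) shuffle_coef X u v * (fstarw u f * fstarw v g).
Proof.
move=> le; rewrite dval_starL ?fnodesM //.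
pose G p := fstarw p.1 f * fstarw p.2 g.
have uWW : uniq [seq (u, v) | u <- W, v <- W].
  by apply: allpairs_uniq => // -[? ?] [? ?].
transitivity (\sum_(w <- W) \sum_(p <- [seq (u, v) | u <- W, v <- W])
    wcoef X w * ((count_mem p (unshuffle w))%:R * G p)).
  apply: eq_big_seq => w wW; rewrite -mulr_sumr fstarwM; congr (_ * _).
  apply: sum_count => // -[u v] /(wdeg_unshuffle deg) /= E /negP[].
  apply/allpairsP; exists (u, v); split=> //=; rewrite memW; rewrite memW -E in wW.
    exact: leq_trans (leq_addr _ _) wW.
  exact: leq_trans (leq_addl _ _) wW.
rewrite exchange_big big_allpairs; apply: eq_bigr => u _; apply: eq_bigr => v _.
(* Shuffles that exceed the bound have coefficient 0 by default, so the sum may be restricted to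
   [W]. *)
rewrite /shuffle_coef (@sum_count _ _ (shuffle u v) W) //; last first.
  by move=> w _; rewrite memW -ltnNge; apply: wcoef_out.
rewrite mulr_suml; apply: eq_bigr => w _.
by rewrite count_shuffle mulrA [wcoef X w * _]mulrC.
Qed.

(** Linear independence is used twice: in [f] for fixed [g], then in [g]. *)
Lemma fstarw_free2 (c : seq nat -> seq nat -> R) :
  (forall f g, (fnodes f + fnodes g <= N)%N ->
     \sum_(u <- W) \sum_(v <- W) c u v * (fstarw u f * fstarw v g) = 0) ->
  forall u v, (wdeg u + wdeg v <= N)%N -> c u v = 0.
Proof.
move=> H u v le.
(* The hypothesis covers only pairs within the joint bound, whereas the argument needs all [f] and
   [g] of at most [N] nodes each. Cutting [c] off beyond the bound repairs this, because a word
   functional is supported on forests with as many nodes as the degree of the word. *)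
pose c' u v := if (wdeg u + wdeg v <= N)%N then c u v else 0.
suff c0 : {in W, forall u, {in W, forall v, c' u v = 0}}.
  have := c0 u _ v; rewrite /c' le; apply; rewrite memW.
    exact: leq_trans (leq_addr _ _) le.
  exact: leq_trans (leq_addl _ _) le.
move=> {le v}u' uW' v' vW' {u}.
pose b g u := \sum_(v <- W) c' u v * fstarw v g.
suff b0 g : (fnodes g <= N)%N -> b g u' = 0.
  exact: (@fstarw_free (c' u') b0 v' vW').
move=> gN; apply: (@fstarw_free (b g)) uW' => f fN.
have E u v : c' u v * (fstarw u f * fstarw v g) =
    if (fnodes f + fnodes g <= N)%N then c u v * (fstarw u f * fstarw v g) else 0.
  rewrite /c'; have [->|/(fstarw_fnodes tauP) ->] := eqVneq (fstarw u f) 0.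
    by rewrite mul0r !mulr0 if_same.
  have [->|/(fstarw_fnodes tauP) ->] := eqVneq (fstarw v g) 0.
    by rewrite !mulr0 if_same.
  by case: ifP => //; rewrite mul0r.
transitivity (\sum_(u <- W) \sum_(v <- W) c' u v * (fstarw u f * fstarw v g)).
  apply: eq_bigr => u _; rewrite mulr_suml; apply: eq_bigr => v _.
  by rewrite -mulrA [fstarw v g * _]mulrC.
under eq_bigr do under eq_bigr do rewrite E.
case: (boolP (fnodes f + fnodes g <= N)%N) => [/H //|_].
by rewrite big1 // => u _; rewrite big1.
Qed.

Lemma starL_prod X f g : (fnodes f + fnodes g <= N)%N ->
  dval (starL X) f * dval (starL X) g =
  \sum_(u <- W) \sum_(v <- W)
    wcoef X u * wcoef X v * (fstarw u f * fstarw v g).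
Proof.
move=> le; rewrite !dval_starL ?(leq_trans _ le) ?leq_addl ?leq_addr //.
rewrite mulr_suml; apply: eq_bigr => u _; rewrite mulr_sumr.
by apply: eq_bigr => v _; rewrite mulrACA.
Qed.

(** Non-empty words have positive degree, so their functionals vanish on the empty forest. *)
Lemma dval_starL1 X : dval (starL X) mone = wcoef X [::].
Proof.
rewrite dval_starL ?fnodes1 // (bigD1_seq [::]) ?memW ?wdeg_nil //=.
rewrite [fstarw _ _]counit1 mulr1 big1 ?addr0 // => w w_nil.
have [->|/(fstarw_fnodes tauP)/eqP] := eqVneq (fstarw w mone) 0; first by rewrite mulr0.
case: w w_nil => // i w _; rewrite fnodes1 wdeg_cons eq_sym addn_eq0.
by rewrite eqn0Ngt (deg_gt0 tauP).
Qed.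

(** Both conditions equate coefficients of the same products of word functionals, by [dval_starLM]
    and [starL_prod]; [fstarw_free2] recovers the coefficients for the converse. *)
Lemma character_starL X : character X <-> multiplicative_upto (starL X).
Proof.
split=> -[X1 XM]; split.
- by rewrite dval_starL1.
- move=> f g le; rewrite dval_starLM // starL_prod //.
  apply: eq_bigr => u _; apply: eq_bigr => v _.
  have [->|/(fstarw_fnodes tauP) Eu] := eqVneq (fstarw u f) 0.
    by rewrite mul0r !mulr0.
  have [->|/(fstarw_fnodes tauP) Ev] := eqVneq (fstarw v g) 0.
    by rewrite !mulr0.
  by rewrite /shuffle_coef XM // -Eu -Ev.
- by rewrite -dval_starL1.
- move=> u v le; apply/eqP; rewrite -subr_eq0; apply/eqP; move: u v le.
  apply: fstarw_free2 => f g le.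
  transitivity (dval (starL X) (mmul f g) - dval (starL X) f * dval (starL X) g).
    rewrite dval_starLM // starL_prod // -sumrB; apply: eq_bigr => u _.
    by rewrite -sumrB; apply: eq_bigr => v _; rewrite mulrBl.
  by rewrite XM // subrr.
Qed.

Lemma Psi_weight (gamma c : R) (Y : dual R d N) :
  (forall f, dval Y f != 0 -> fweight gamma f <= c) ->
  forall w, wcoef (Psi Y) w != 0 -> wweight gamma deg deg0 w <= c.
Proof.
move=> H w nz; rewrite leNgt; apply/negP => lt; case/eqP: nz.
have [le|gt] := leqP (wdeg w) N; last exact: wcoef_out.
(* Only coefficients of words heavier than [c] are kept. The words that contribute at a forest [f]
   all have the weight of [f], so the sum is either 0 or the full value of [Y] at [f], which
   vanishes when [f] is heavier than [c]. *)
pose b w := if c < wweight gamma deg deg0 w then wcoef (Psi Y) w else 0.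
suff b0 : {in W, forall w, b w = 0} by have := b0 w; rewrite memW le /b lt; apply.
apply: fstarw_free => f fN.
transitivity (if c < fweight gamma f then dval Y f else 0); last first.
  by case: ltP => // ltf; apply/eqP; apply: contraTT ltf => /H; rewrite -leNgt.
have := dval_starL (Psi Y) fN; rewrite (PsiK tauP) => ->.
transitivity (\sum_(v <- W)
    if c < fweight gamma f then wcoef (Psi Y) v * fstarw v f else 0).
  apply: eq_bigr => v _; rewrite /b.
  have [->|/(fstarw_weight tauP gamma) ->] := eqVneq (fstarw v f) 0.
    by rewrite !mulr0 if_same.
  by case: ifP => // _; rewrite mul0r.
by case: ifP => // _; rewrite big1.
Qed.

End ShuffleDuality.

(** * The map Mtilde *)

Lemma powR_unit_le (R : realType) (x a b : R) :
  0 <= x <= 1 -> 0 <= a -> a <= b -> x `^ b <= x `^ a.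
Proof.
case/andP=> x0 x1 a0 ab; have [xz|xn0] := eqVneq x 0; last first.
  by apply: ger_powR; rewrite // lt_neqAle eq_sym xn0 x0.
(* At x = 0 the convention 0^0 = 1 matters: for b = 0 the hypotheses force a = 0. *)
have [b0|bn0] := eqVneq b 0; last by rewrite xz powR0 // powR_ge0.
by have -> : a = b by apply/eqP; rewrite eq_le ab b0 a0.
Qed.

Section Proposition.
Context (R : realType) (d N : nat) (gamma : R) (gamma01 : 0 < gamma < 1).
Context (tau : nat -> BCK R d) (deg deg0 : nat -> nat).
Context (tauP : FC_basis N tau deg deg0).
Context (M : {linear BCK R d -> BCK R d}).
Context (M_mul : forall x y, M (x * y) = M x * M y) (M_one : M 1 = 1).
Context (M_coprod : forall x, tensor_map M M (coprod x) = coprod (M x)).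
Context (M_tree : forall (t : tree d) f, f \in msupp (M (tvec R t)) ->
  exists t' : tree d, [/\ f = ucm t',
    tweight gamma t <= tweight gamma t' & (tnodes t' <= tnodes t)%N]).
Local Notation TN := (TN R N deg).
Local Notation starL := (@starL R d N deg tau).
Local Notation Psi := (@Psi R d N deg tau).
Local Notation starw := (@starw R d N tau).
Local Notation wdeg := (wdeg deg).
Local Notation wweight := (wweight gamma deg deg0).

Lemma wweight_ge0 w : 0 <= wweight w.
Proof.
case/andP: gamma01 => g0 g1; apply: sumr_ge0 => i _.
by rewrite addr_ge0 // mulr_ge0 // ?subr_ge0 ltW.
Qed.

Definition Mtilde (X : TN) : TN := Psi (adjoint M (starL X)).

Lemma Mtilde_linear : linear Mtilde.
Proof.
move=> c X Y; rewrite /Mtilde (linearP starL) (adjoint_linear M).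
exact: (Psi_is_linear tauP).
Qed.

Lemma Mtilde_Psi (X : dual R d N) : Psi (adjoint M X) = Mtilde (Psi X).
Proof. by rewrite /Mtilde (PsiK tauP). Qed.

Lemma Mtilde_nil : Mtilde (wvec [::]) = wvec [::].
Proof.
rewrite /Mtilde (starL_wvec tauP) [starw [::]]/= (adjoint_dunit N M_mul M_one M_tree).
by rewrite -(@Psi_starw _ _ _ _ _ _ tauP) // wdeg_nil.
Qed.

Lemma Mtilde_concat X Y : Mtilde (concat X Y) = concat (Mtilde X) (Mtilde Y).
Proof.
rewrite /Mtilde (starL_concat tauP).
by rewrite (adjoint_star M_mul M_one M_coprod M_tree) (Psi_star tauP).
Qed.

Lemma concat_wvec u v : concat (wvec u) (wvec v) = wvec (u ++ v) :> TN.
Proof.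
apply: (can_inj (starLK tauP)).
by rewrite (starL_concat tauP) !(starL_wvec tauP) starw_cat.
Qed.

Lemma Mtilde_character X : character X -> character (Mtilde X).
Proof.
have [W uW memW] := words_finite tauP.
move/(character_starL tauP uW memW) => H; apply/(character_starL tauP uW memW).
rewrite /Mtilde (PsiK tauP).
exact: (adjoint_multiplicative M_mul M_one M_tree).
Qed.

(** If the adjoint of a functional is non-zero at [f], then [M f] contains a forest of the support
    of that functional, at least as heavy as [f]; for the word [u] this forest has the weight of
    [u]. *)
Lemma Mtilde_weight u w : wcoef (Mtilde (wvec u)) w != 0 ->
  wweight w <= wweight u.
Proof.
have [W uW memW] := words_finite tauP.
apply: (Psi_weight tauP uW memW) => f; rewrite (starL_wvec tauP).
have [le|gt] := leqP (fnodes f) N; last by rewrite dval_out ?eqxx.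
rewrite dval_adjoint // => /lext_neq0[g /(M_forest M_mul M_one M_tree)[fg gf]].
rewrite dval_starw ?(leq_trans gf) // => /(fstarw_weight tauP gamma) <-.
exact: fg.
Qed.

(** Expanding [X] over finitely many words, with coefficients of [Mtilde] independent of [X],
    reduces the estimate for a path to its separate words. *)
Lemma Mtilde_coef W : uniq W -> (forall w, (w \in W) = (wdeg w <= N)%N) ->
  forall X (w : word N deg), (Mtilde X)@_w =
    \sum_(u <- W) wcoef X u * wcoef (Mtilde (wvec u)) (val w).
Proof.
move=> uW memW X w.
have coefD (Y Z : TN) : (Y + Z)@_w = Y@_w + Z@_w by apply: mcoeffD.
have coefZ c (Y : TN) : (c *: Y)@_w = c * Y@_w by apply: mcoeffZ.
pose h (Y : TN) : R^o := (Mtilde Y)@_w.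
have hl : linear h by move=> c Y Z; rewrite /h Mtilde_linear coefD coefZ.
pose H : {linear TN -> R^o} := HB.pack h (GRing.isLinear.Build R TN R^o *:%R h hl).
transitivity (H (\sum_(u <- W) wcoef X u *: wvec u)).
  by rewrite -(TN_expand uW memW).
rewrite linear_sum; apply: eq_bigr => u _.
by rewrite linearZ /= wcoef_val.
Qed.

Lemma Mtilde_ARP X : ARP gamma deg0 X -> ARP gamma deg0 (fun s t => Mtilde (X s t)).
Proof.
case=> Xchar Xtt Xchen Xbound; split.
- by move=> s t hs ht; apply/Mtilde_character/Xchar.
- by move=> t ht; rewrite Xtt // Mtilde_nil.
- by move=> s u t hs hu ht; rewrite -Mtilde_concat -Xchen.
move=> w; have [W uW memW] := words_finite tauP.
suff [C HC] : exists C : R, forall s t, 0 <= s <= 1 -> 0 <= t <= 1 ->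
    `|\sum_(u <- W) wcoef (X s t) u * wcoef (Mtilde (wvec u)) (val w)| <=
    C * `|t - s| `^ wweight (val w).
  by exists C => s t hs ht; rewrite (Mtilde_coef uW memW) HC.
(* The constant is built one word at a time: a word [u] whose image has no component on [w] adds
   nothing, and any other weighs at least as much as [w]. *)
elim: (W) => [|u V [C HC]].
  by exists 0 => s t _ _; rewrite big_nil normr0 mul0r.
have [m0|mn0] := eqVneq (wcoef (Mtilde (wvec u)) (val w)) 0.
  by exists C => s t hs ht; rewrite big_cons m0 mulr0 add0r HC.
have [C' HC'] : exists C' : R, forall s t, 0 <= s <= 1 -> 0 <= t <= 1 ->
    `|wcoef (X s t) u| <= C' * `|t - s| `^ wweight u.
  have [le|gt] := leqP (wdeg u) N.
    have [C' HC'] := Xbound (exist _ u le); exists C' => s t hs ht.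
    by rewrite -[u]/(val (exist (fun w => wdeg w <= N)%N u le)) wcoef_val HC'.
  by exists 0 => s t _ _; rewrite wcoef_out // normr0 mul0r.
(* [C'] may be negative, so its absolute value is taken before the exponent is lowered from the
   weight of [u] to that of [w]. *)
exists (`|C'| * `|wcoef (Mtilde (wvec u)) (val w)| + C) => s t hs ht.
rewrite big_cons (le_trans (ler_normD _ _)) // mulrDl lerD ?HC //.
rewrite normrM mulrAC ler_wpM2r //.
apply: le_trans (HC' s t hs ht) _.
apply: (@le_trans _ _ (`|C'| * `|t - s| `^ wweight u)).
  by rewrite ler_wpM2r ?powR_ge0 ?ler_norm.
rewrite ler_wpM2l //; apply: powR_unit_le; last exact: Mtilde_weight.
  rewrite normr_ge0 /= ler_norml.
  case/andP: hs => s0 s1; case/andP: ht => t0 t1.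
  by rewrite lerBrDr lerBlDr (le_trans _ t0) ?(le_trans t1) ?lerDl // addrC subr_le0.
exact: wweight_ge0.
Qed.

End Proposition.

(** * Uniqueness of the multiplicative extension *)

Section Uniqueness.
Context (R : realType) (d N : nat) (tau : nat -> BCK R d) (deg : nat -> nat).
Context (M : {linear BCK R d -> BCK R d}).

(** Induction on the word: its first letter and the rest both stay within the degree bound, so the
    defining equations determine every value. *)
Lemma is_Mtilde_uniq (Mt Mt' : {linear TN R N deg -> TN R N deg}) :
  is_Mtilde tau M Mt -> is_Mtilde tau M Mt' -> Mt' =1 Mt.
Proof.
case=> nil cat letter [nil' cat' letter']; apply: linear_wvec_eq.
elim=> [|i w IH] le; first by rewrite nil nil'.
have le' := le; rewrite wdeg_cons in le'.
have lei := leq_trans (leq_addr _ _) le'.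
have lew := leq_trans (leq_addl _ _) le'.
rewrite [LHS](cat' [:: i] w le) [RHS](cat [:: i] w le).
by rewrite (letter _ lei) (letter' _ lei) (IH lew).
Qed.

End Uniqueness.

Theorem proposition3p6 (R : realType) (d N : nat) (gamma : R)
  (gamma01 : 0 < gamma < 1) (NE : N%:Z = Num.floor (gamma^-1))
  (tau : nat -> BCK R d) (deg deg0 : nat -> nat)
  (tauP : FC_basis N tau deg deg0)
  (M : {linear BCK R d -> BCK R d})
  (M_mul : forall x y, M (x * y) = M x * M y) (M_one : M 1 = 1)
  (M_coprod : forall x, tensor_map M M (coprod x) = coprod (M x))
  (M_tree : forall (t : tree d) f, f \in msupp (M (tvec R t)) ->
     exists t' : tree d, [/\ f = ucm t',
       tweight gamma t <= tweight gamma t' & (tnodes t' <= tnodes t)%N]) :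
  exists Mt : {linear TN R N deg -> TN R N deg},
    [/\ is_Mtilde tau M Mt,
        forall Mt' : {linear TN R N deg -> TN R N deg},
          is_Mtilde tau M Mt' -> Mt' =1 Mt,
        forall X : dual R d N,
          Psi deg tau (adjoint M X) = Mt (Psi deg tau X)
      & forall X : R -> R -> TN R N deg,
          ARP gamma deg0 X -> ARP gamma deg0 (fun s t => Mt (X s t))].
Proof.
pose Mt : {linear TN R N deg -> TN R N deg} := HB.pack (@Mtilde R d N tau deg M)
  (GRing.isLinear.Build R _ _ *:%R (@Mtilde R d N tau deg M) (Mtilde_linear tauP M)).
have MtP : is_Mtilde tau M Mt.
  split=> [|u v _|i _] /=.
  - exact: (Mtilde_nil tauP M_mul M_one M_tree).
  - rewrite -(concat_wvec tauP).
    exact: (Mtilde_concat tauP M_mul M_one M_coprod M_tree).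
  - by rewrite /Mtilde (starL_wvec tauP) starw1.
exists Mt; split=> //.
- by move=> Mt'; apply: is_Mtilde_uniq.
- exact: (Mtilde_Psi tauP).
- exact: (Mtilde_ARP gamma01 tauP M_mul M_one M_coprod M_tree).
Qed.
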